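(* Let $d\ge 3$ be a fixed integer, let $\varepsilon>0$ be a fixed sufficiently small constant, and let $b>0$ be a fixed, sufficiently large constant (depending on $d$ and $\varepsilon$). Let $p=p(n)$ be primes with $p\to\infty$ and $p\le n^{1/3-\varepsilon}$. Let $\mathcal{N}$ be the set of $p$-tuples $(n_0,\dots,n_{p-1})$ of non-negative integers with $\sum_{j} n_j=n$, $(n_0,\dots,n_{p-1})\ne (n,0,\dots,0)$, which are not equidistributed, i.e. $\sum_{j=0}^{p-1}\left(\frac{n_j}{n}-\frac1p\right)^2> \frac{b\log n}{n}$. Then, as $n\to\infty$, $$\sum_{(n_0,\dots,n_{p-1})\in\mathcal{N}} \binom{n}{n_0,\dots,n_{p-1}}\frac{p^{(d-1)n}\prod_{j=0}^{p-1}(dn_j)!}{(dn)!}\,\mathbb{P}\big(X_1+\dots+X_n=(dn_0,\dots,dn_{p-1})\big)=o(1).$$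
   Context: For $\mathbf{x}=(x_1,\dots,x_d)\in\mathbb{F}_p^d$ let $\Phi(\mathbf{x})=(m_0,\dots,m_{p-1})\in\mathbb{Z}_{\ge0}^p$, where $m_j$ is the number of coordinates of $\mathbf{x}$ equal to $j$ (elements of $\mathbb{F}_p$ identified with $\{0,\dots,p-1\}$). Let $\mathcal{U}_{d,p}$ be the multiset $\{\Phi(\mathbf{x}):\mathbf{x}\in\mathbb{F}_p^d,\ \sum_{i=1}^d x_i=0\}$, which has $p^{d-1}$ elements counted with multiplicity. $X_1,\dots,X_n$ are independent random vectors, each uniformly distributed over the multiset $\mathcal{U}_{d,p}$. *)

(* Defs.v *)
From HB Require Import structures.
From mathcomp Require Import all_boot all_order all_algebra.
From mathcomp Require Import all_classical all_reals all_analysis.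

Set Implicit Arguments.
Unset Strict Implicit.
Unset Printing Implicit Defensive.

Import Order.TTheory GRing.Theory Num.Theory.
Import numFieldNormedType.Exports.

Local Open Scope classical_set_scope.
Local Open Scope ring_scope.

(* The carrier of 'F_p is an ordinal type; for p prime, the underlying nat of
   an element is its representative in {0, ..., p - 1}. *)
Definition Phi (p d : nat) (x : 'rV['F_p]_d) : p.-tuple nat :=
  [tuple #|[set i : 'I_d | x 0%R i == j :> nat]%SET| | j < p].

(* The multiset is listed with multiplicities: one entry for each x. *)
Definition multisetU (d p : nat) : seq (p.-tuple nat) :=
  [seq Phi x | x in [pred x : 'rV['F_p]_d | \sum_(i < d) x 0 i == 0]].

Definition uniform_over (disp : measure_display) (T : measurableType disp)
    (R : realType) (P : probability T R) (p : nat)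
    (X : {RV P >-> p.-tuple nat}) (U : seq (p.-tuple nat)) : Prop :=
  forall u : p.-tuple nat,
    P (X @^-1` [set u]) = ((count_mem u U)%:R / (size U)%:R)%:E.

Definition mutually_independent (disp disp' : measure_display)
    (T : measurableType disp) (S : measurableType disp') (R : realType)
    (P : probability T R) (I : finType) (X : I -> {RV P >-> S}) : Prop :=
  forall (J : {set I}) (B : I -> set S),
    (forall i, measurable (B i)) ->
    P (\bigcap_(i in [set` J]) (X i @^-1` B i))
      = (\prod_(i in J) P (X i @^-1` B i))%E.

(* Non-negative integers with sum n are at most n, so the p-tuples
   (n_0, ..., n_(p-1)) are taken in the finite type {ffun 'I_p -> 'I_n.+1}. *)
Definition calN (R : realType) (b : R) (n p : nat) :
    {set {ffun 'I_p -> 'I_n.+1}} :=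
  [set m : {ffun 'I_p -> 'I_n.+1} |
    [&& (\sum_(j < p) m j == n)%N,
        ~~ [forall j : 'I_p, m j == (if j == 0 :> nat then n else 0)%N :> nat]
      & b * ln n%:R / n%:R
          < \sum_(j < p) ((m j)%:R / n%:R - p%:R^-1) ^+ 2]].

Definition multinomial (R : realType) (n p : nat)
    (m : {ffun 'I_p -> 'I_n.+1}) : R :=
  n`!%:R / \prod_(j < p) (m j)`!%:R.

Definition prob_sum_eq (disp : measure_display) (T : measurableType disp)
    (R : realType) (P : probability T R) (n p d : nat)
    (X : 'I_n -> {RV P >-> p.-tuple nat}) (m : {ffun 'I_p -> 'I_n.+1}) : R :=
  fine (P [set t : T | forall j : 'I_p,
             (\sum_(i < n) tnth (X i t) j = d * m j)%N]).

(* Main.v *)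
Require Import Defs.
From HB Require Import structures.
From mathcomp Require Import all_boot all_order all_algebra.
From mathcomp Require Import all_classical all_reals all_analysis.
From mathcomp Require Import ring lra zify.

(* Write q_j = n_j / n and, for z >= 0, let F(z) be the sum over the x in F_p^d
   with zero coordinate sum of the products z_(x_1) ... z_(x_d).  Markov's
   inequality for the generating function gives
     p^((d-1)n) P(X_1 + ... + X_n = d (n_j)) <= F(z)^n / prod_j z_j^(d n_j).

   Dense tuples (n - n_0 >= delta n).  Take z_j = q_j^((d-1)/d).  Up to a factor
   n^O(p) the summand is at most F(z)^n, and F(z) <= 1 is Young's inequality,
   which here follows from AM-GM applied to the numbers prod_(l != i) q_(x_l).
   The AM-GM defect bounds 1 - F(z) below by the average, over reflections
   x -> c - s - x with s distributed as q, of the squared displacement of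
   g = sqrt q.  With h the squared norm of the part of g orthogonal to the
   constants, this average is at least of order h (1 - |q - 1/p|_1); composing
   two reflections into a translation of Z/p, it is also at least of order
   delta h / p^2, because a translation-almost-invariant g is almost constant.
   Hence 1 - F(z) is at least of order min (b p log n / n, 1 / p^2), which beats
   the n^O(p) factor because p^3 log n = o(n).  Tuples with n_j > (1 - 1/d) n for
   some j <> 0 have probability zero once p > d.

   Sparse tuples (r = n - n_0 < delta n).  Take z_0 = 1 and
   z_j = sqrt (r / n) (n_j / r)^((d-1)/d).  Nonzero rows have at least two nonzero
   entries, so the same Young inequality gives F(z) <= 1 + 2^(d-1) r / n and the
   summand is at most (C sqrt (r / n))^r; this is summed over all compositions
   using p^3 = o(n) if r <= p and p -> oo if r > p. *)

Set Implicit Arguments.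
Unset Strict Implicit.
Unset Printing Implicit Defensive.

Import Order.TTheory GRing.Theory Num.Theory.
Import numFieldNormedType.Exports.

Local Open Scope classical_set_scope.
Local Open Scope ring_scope.

(** * Sums of products over vectors with a prescribed coordinate sum *)

Section ConstrainedSums.
Variables (R : realType) (G : finZmodType).
Implicit Types (f : nat -> G -> R) (q g z : G -> R) (c : G).

(** The [d]-fold convolution of [f 0], ..., [f (d-1)] at [c]. The factors may depend on the position
    because AM-GM produces products with unequal factors. *)
Definition csum f d c : R :=
  \sum_(x : 'rV[G]_d | \sum_i x 0 i == c) \prod_(i < d) f i (x 0 i).

Lemma csum0 f c : csum f 0 c = (c == 0)%:R.
Proof.
rewrite /csum big_mkcond /= (big_pred1 (0 : 'rV[G]_0)) => [|x]; last first.
  by rewrite [x]thinmx0 /= eqxx.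
by rewrite !big_ord0 eq_sym; case: (_ == _).
Qed.

Lemma csumS f d c : csum f d.+1 c = \sum_s f d s * csum f d (c - s).
Proof.
pose h (sy : G * 'rV[G]_d) : 'rV[G]_d.+1 :=
  \row_i (if unlift ord_max i is Some j then sy.2 0 j else sy.1).
have hl s y i : h (s, y) 0 (widen_ord (leqnSn d) i) = y 0 i.
  rewrite mxE; have -> : widen_ord (leqnSn d) i = lift ord_max i.
    by apply: val_inj; rewrite /= /bump leqNgt ltn_ord.
  by rewrite liftK.
have hm s y : h (s, y) 0 ord_max = s by rewrite mxE unlift_none.
rewrite /csum (reindex h) /=; last first.
  exists (fun x => (x 0 ord_max, \row_i x 0 (widen_ord (leqnSn d) i))).
    move=> [s y] _; rewrite hm; congr pair.
    by apply/rowP => i; rewrite mxE hl.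
  move=> x _; apply/rowP => i; rewrite mxE /=.
  case: unliftP => [j ->|-> //]; rewrite mxE; congr (x 0 _).
  by apply: val_inj; rewrite /= /bump leqNgt ltn_ord.
transitivity (\sum_(sy : G * 'rV[G]_d | \sum_i sy.2 0 i == c - sy.1)
   f d sy.1 * \prod_(i < d) f i (sy.2 0 i)).
  apply: eq_big => [[s y]|[s y] _] /=.
    rewrite big_ord_recr /= hm; under eq_bigr do rewrite hl.
    by rewrite eq_sym [RHS]eq_sym subr_eq.
  rewrite big_ord_recr /= hm mulrC; congr (_ * _).
  by under eq_bigr do rewrite hl.
rewrite -(pair_big_dep xpredT (fun s (y : 'rV[G]_d) => \sum_i y 0 i == c - s)
   (fun s (y : 'rV[G]_d) => f d s * \prod_(i < d) f i (y 0 i))) /=.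
by apply: eq_bigr => s _; rewrite mulr_sumr.
Qed.

Lemma csum_ge0 f d c : (forall i s, 0 <= f i s) -> 0 <= csum f d c.
Proof. by move=> f0; apply: sumr_ge0 => x _; apply: prodr_ge0. Qed.

Lemma csum_total f d : \sum_c csum f d c = \prod_(i < d) \sum_s f i s.
Proof.
elim: d => [|d IH].
  rewrite big_ord0 (bigD1 0) //= csum0 eqxx big1 ?addr0// => c /negPf c0.
  by rewrite csum0 c0.
rewrite big_ord_recr /= -IH mulrC mulr_suml.
rewrite (eq_bigr _ (fun c _ => csumS f d c)) exchange_big /=.
apply: eq_bigr => s _; rewrite -mulr_sumr; congr (_ * _).
by rewrite [RHS](reindex_inj (addIr (- s))).
Qed.

(** The coordinate [i] absorbs the constraint: for every choice of the others exactly one value at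
    [i] gives the sum [c]. *)
Lemma csum_free f d c i : (i < d)%N -> (forall s, f i s = 1) ->
  csum f d c = \prod_(l < d | l != i :> nat) \sum_s f l s.
Proof.
move=> + fi1; elim: d c => // d IH c; rewrite ltnS leq_eqVlt csumS.
rewrite [RHS]big_mkcond big_ord_recr /= => /orP[/eqP id|id].
  subst i; rewrite eqxx mulr1.
  transitivity (\sum_s csum f d s).
    rewrite [RHS](reindex_inj (inj_comp (addrI c) oppr_inj)).
    by apply: eq_bigr => s _; rewrite fi1 mul1r.
  by rewrite csum_total; apply: eq_bigr => l _; rewrite ltn_eqF.
rewrite gtn_eqF// -big_mkcond mulrC mulr_suml.
by apply: eq_bigr => s _; rewrite IH.
Qed.
End ConstrainedSums.

(** * Young's inequality through AM-GM *)

Section Young.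
Variables (R : realType) (G : finZmodType).
Implicit Types (q g z : G -> R) (c : G).

(* AM-GM applied to the [m.+2] numbers obtained from the products
   [A_i = \prod_(l != i) q (x_l)] by replacing both [A_0] and [A_1] by their
   geometric mean. *)
Lemma csum_AGM m q g z : (forall s, 0 <= q s) -> (forall s, 0 <= g s) ->
  (forall s, 0 <= z s) -> (forall s, g s ^+ 2 = q s) ->
  (forall s, z s ^+ m.+2 = q s ^+ m.+1) ->
  m.+2%:R * csum (fun=> z) m.+2 0 <=
    2 * csum (fun i => if (i < 2)%N then g else q) m.+2 0
    + m%:R * (\sum_s q s) ^+ m.+1.
Proof.
move=> q0 g0 z0 gq zq.
(* [w i l] is the factor of the [i]-th number at coordinate [l]. Rows 0 and 1 coincide and carry the
   geometric mean; a later row [i] leaves its coordinate [i] free. *)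
pose w (i l : nat) : G -> R := if (i < 2)%N then (if (l < 2)%N then g else q)
  else (if l == i then fun=> 1 else q).
have w0 i l s : 0 <= w i l s by rewrite /w; do 2 case: ifP => _.
have wq (l : 'I_m.+2) s : \prod_(i < m.+2) w i l s = q s ^+ m.+1.
  rewrite !big_ord_recl /w /=; case: ltnP => l2.
    under eq_bigr => i _.
      rewrite (_ : (l == bump 0 (bump 0 i) :> nat) = false); last first.
        by apply/negP => /eqP le; move: l2; rewrite le.
      over.
    by rewrite prodr_const card_ord mulrA -expr2 gq -exprS.
  have lm : (l - 2 < m)%N by have := ltn_ord l; lia.
  rewrite (bigD1 (Ordinal lm)) //= ifT; last by rewrite /bump /=; lia.
  rewrite mul1r (eq_bigr (fun=> q s)) => [|i il]; last first.
    rewrite ifN//; apply: contra il => /eqP li; rewrite -val_eqE /=.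
    by move: li; rewrite /bump /=; lia.
  have mS : m = m.-1.+1 by lia.
  by rewrite prodr_const cardC1 card_ord -!exprS -mS.
have pt (x : 'rV[G]_m.+2) : m.+2%:R * \prod_(i < m.+2) z (x 0 i) <=
    \sum_(i < m.+2) \prod_(l < m.+2) w i l (x 0 l).
  pose B (i : 'I_m.+2) := \prod_(l < m.+2) w i l (x 0 l).
  have B0 i : 0 <= B i by exact: prodr_ge0.
  rewrite mulrC -ler_pdivlMr ?ltr0n//.
  rewrite -(@ler_pXn2r _ m.+2) ?nnegrE ?prodr_ge0 ?divr_ge0 ?sumr_ge0//; last first.
    by move=> i _; exact: B0.
  have [+ _] := @leif_AGM _ _ [pred i : 'I_m.+2 | true] B (fun i _ => B0 i).
  rewrite card_ord; apply: le_trans.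
  rewrite /B exchange_big /= -prodrXl.
  by apply: ler_prod => i _; rewrite zq wq lexx exprn_ge0.
rewrite {1}/csum mulr_sumr.
apply: (le_trans (ler_sum _ (fun x _ => pt x))).
rewrite exchange_big /= !big_ord_recl /= -/(csum (w 0%N) m.+2 0) addrA.
rewrite -[X in _ + X + _]/(csum (w 0%N) m.+2 0) -mulr2n mulr_natl.
rewrite lerD2l (eq_bigr (fun=> (\sum_s q s) ^+ m.+1)) ?sumr_const ?card_ord.
  by rewrite mulr_natl.
move=> i _; rewrite -/(csum (w i.+2) m.+2 0) (@csum_free _ _ _ _ _ i.+2)//.
- rewrite (eq_bigr (fun=> \sum_s q s)) => [|l /negPf li]; last by rewrite /w/= li.
  have im : (i.+2 < m.+2)%N by have := ltn_ord i; lia.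
  rewrite (eq_bigl (fun l => l \in predC1 (Ordinal im))) => [|l]; last first.
    by rewrite inE -val_eqE.
  by rewrite prodr_const cardC1 card_ord.
- by have := ltn_ord i; lia.
- by move=> s; rewrite /w/= eqxx.
Qed.

End Young.

(** * Correlations of a function with its reflections *)

Section Reflections.
Variables (R : realType) (G : finZmodType).
Implicit Types (q g u : G -> R) (c : G).

Lemma sum_sub g c : \sum_x g (c - x) = \sum_x g x.
Proof. by rewrite [RHS](reindex_inj (inj_comp (addrI c) oppr_inj)). Qed.

Lemma sum_addr g c : \sum_x g (x + c) = \sum_x g x.
Proof. by rewrite [RHS](reindex_inj (addIr c)). Qed.

Lemma csum2 g q c :
  csum (fun i => if (i < 2)%N then g else q) 2 c = \sum_x g x * g (c - x).
Proof.
rewrite csumS /=; apply: eq_bigr => x _; congr (_ * _).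
rewrite csumS (bigD1 (c - x)) //= csum0 subrr eqxx mulr1 big1 ?addr0// => y yc.
by rewrite csum0 subr_eq0 eq_sym (negPf yc) mulr0.
Qed.

(** A further coordinate weighted by [q] averages the sum over shifted values of [c], so a bound
    uniform in [c] survives at the price of a factor [\sum_s q s]. *)
Lemma csum_le g q m j (B : R) : (forall s, 0 <= q s) ->
  (forall c, csum (fun i => if (i < 2)%N then g else q) m.+2 c <= B) ->
  forall c, csum (fun i => if (i < 2)%N then g else q) (j + m.+2) c
              <= (\sum_s q s) ^+ j * B.
Proof.
move=> q0 HB; elim: j => [|j IH] c; first by rewrite mul1r.
rewrite csumS (_ : (j + m.+2 < 2)%N = false) ?addnS// -?addnS.
rewrite exprS -mulrA mulr_suml; apply: ler_sum => s _.
by apply: ler_wpM2l.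
Qed.

Lemma sum_refl_le u c : \sum_x u x * u (c - x) <= \sum_x u x ^+ 2.
Proof.
have : 0 <= \sum_x (u x - u (c - x)) ^+ 2 by apply: sumr_ge0 => x _; exact: sqr_ge0.
have -> : \sum_x (u x - u (c - x)) ^+ 2 =
    \sum_x u x ^+ 2 + \sum_x u (c - x) ^+ 2 - 2 * \sum_x u x * u (c - x).
  rewrite mulr_sumr -big_split -sumrB /=; apply: eq_bigr => x _; ring.
by rewrite (sum_sub (fun x => u x ^+ 2)) /=; lra.
Qed.

Lemma sum_refl_norm_le u c : `|\sum_x u x * u (c - x)| <= \sum_x u x ^+ 2.
Proof.
rewrite ler_norml sum_refl_le andbT.
have : 0 <= \sum_x (u x + u (c - x)) ^+ 2 by apply: sumr_ge0 => x _; exact: sqr_ge0.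
have -> : \sum_x (u x + u (c - x)) ^+ 2 =
    \sum_x u x ^+ 2 + \sum_x u (c - x) ^+ 2 + 2 * \sum_x u x * u (c - x).
  rewrite mulr_sumr -!big_split /=; apply: eq_bigr => x _; ring.
by rewrite (sum_sub (fun x => u x ^+ 2)) /=; lra.
Qed.

(* [defect g] is the squared norm of the component of the unit vector [g]
   orthogonal to the constants. *)
Definition defect g : R := 1 - (\sum_x g x) ^+ 2 / #|G|%:R.

Let N : R := #|G|%:R.
Let N0 : N != 0.
Proof. by rewrite pnatr_eq0 -lt0n; apply/card_gt0P; exists 0. Qed.
Let NE : N = \sum_(x : G) 1. Proof. by rewrite sumr_const. Qed.

(** Split [g] into its mean [a] and the rest [u]. The mean contributes [1 - defect g]. The
    reflection correlations of [u] sum to zero, so [q] may be replaced by its deviation from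
    uniform, and each is at most [defect g] in absolute value. *)
Lemma refl_mix_le_L1 q g c :
  \sum_s q s = 1 -> \sum_x g x ^+ 2 = 1 ->
  \sum_s q s * (\sum_x g x * g (c - s - x)) <=
    1 - defect g * (1 - \sum_s `|q s - #|G|%:R^-1|).
Proof.
move=> q1 g1; pose a := (\sum_x g x) / N; pose u x := g x - a.
have su0 : \sum_x u x = 0.
  by rewrite sumrB sumr_const -mulr_natr -/N /a divfK ?subrr.
have aN : a * N = \sum_x g x by rewrite /a divfK.
have aaN : a ^+ 2 * N = (\sum_x g x) ^+ 2 / N.
  by rewrite /a expr2 expr2 !mulrA mulfVK//; ring.
have su2 : \sum_x u x ^+ 2 = defect g.
  transitivity (\sum_x g x ^+ 2 - 2 * a * \sum_x g x + a ^+ 2 * N).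
    rewrite NE !mulr_sumr -sumrB -big_split /=; apply: eq_bigr => x _.
    rewrite /u; ring.
  rewrite g1 -aN /defect -/N -aaN; ring.
have gE s : \sum_x g x * g (s - x) = 1 - defect g + \sum_x u x * u (s - x).
  have -> : 1 - defect g = a ^+ 2 * N by rewrite aaN /defect; ring.
  have -> : \sum_x g x * g (s - x) = \sum_x u x * u (s - x)
      + a * \sum_x u x + a * \sum_x u (s - x) + a ^+ 2 * N.
    rewrite NE !mulr_sumr -!big_split /=; apply: eq_bigr => x _; rewrite /u; ring.
  by rewrite sum_sub su0; ring.
pose r s := \sum_x u x * u (c - s - x).
have sr0 : \sum_s r s = 0.
  rewrite exchange_big big1//= => x _; rewrite -mulr_sumr.
  rewrite (eq_bigr (fun s => u (c - x - s))) ?sum_sub ?su0 ?mulr0// => s _.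
  by rewrite addrAC.
have -> : \sum_s q s * (\sum_x g x * g (c - s - x)) =
    1 - defect g + \sum_s (q s - N^-1) * r s.
  transitivity (\sum_s (1 - defect g) * q s + \sum_s q s * r s).
    rewrite -big_split /=; apply: eq_bigr => s _; rewrite gE /r; ring.
  rewrite -mulr_sumr q1 mulr1; congr (_ + _).
  have e0 : \sum_s N^-1 * r s = 0 by rewrite -mulr_sumr sr0 mulr0.
  rewrite -[LHS]subr0 -[X in _ - X]e0 -sumrB; apply: eq_bigr => s _; ring.
have -> : 1 - defect g * (1 - \sum_s `|q s - #|G|%:R^-1|) =
    1 - defect g + \sum_s `|q s - N^-1| * defect g.
  by rewrite -mulr_suml /N; ring.
rewrite lerD2l; apply: ler_sum => s _.
apply: le_trans (ler_norm _) _; rewrite normrM ler_wpM2l//.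
by rewrite -su2; exact: sum_refl_norm_le.
Qed.

(* The composition of two reflections is a translation. *)
Lemma refl_mix_transl q g c : (forall s, 0 <= q s) ->
  \sum_s q s = 1 -> \sum_x g x ^+ 2 = 1 ->
  \sum_s \sum_t q s * q t * (\sum_x (g x - g (x + (s - t))) ^+ 2) <=
    8 * (1 - \sum_s q s * (\sum_x g x * g (c - s - x))).
Proof.
move=> q0 q1 g1; pose D s := \sum_x (g (c - s - x) - g x) ^+ 2.
have DE s : D s = 2 - 2 * \sum_x g x * g (c - s - x).
  have -> : D s = \sum_x g (c - s - x) ^+ 2 + \sum_x g x ^+ 2
     - 2 * \sum_x g x * g (c - s - x).
    rewrite mulr_sumr -big_split -sumrB /=; apply: eq_bigr => x _; ring.
  by rewrite (sum_sub (fun x => g x ^+ 2)) g1.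
(* Substituting [c - s - x] for [x] turns the two arguments into two reflections of one point [x],
   so both values are compared with [g x]. *)
have tr s t : \sum_x (g x - g (x + (s - t))) ^+ 2 <= 2 * D s + 2 * D t.
  rewrite -(sum_sub (fun x => (g x - g (x + (s - t))) ^+ 2) (c - s)).
  rewrite /D !mulr_sumr -big_split /=; apply: ler_sum => x _.
  have -> : c - s - x + (s - t) = c - t - x.
    by rewrite addrAC [c - s + _]addrA subrK.
  have := sqr_ge0 ((g (c - s - x) - g x) + (g (c - t - x) - g x)).
  by rewrite expr2 => H; nra.
have -> : 8 * (1 - \sum_s q s * (\sum_x g x * g (c - s - x))) =
    \sum_s \sum_t q s * q t * (2 * D s + 2 * D t).
  have -> : \sum_s \sum_t q s * q t * (2 * D s + 2 * D t) =
      4 * \sum_s q s * D s.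
    transitivity (\sum_s (2 * (q s * D s) + 2 * (\sum_t q t * D t) * q s)).
      apply: eq_bigr => s _.
      have -> : 2 * (q s * D s) = \sum_t 2 * (q s * D s) * q t.
        by rewrite -mulr_sumr q1 mulr1.
      have -> : 2 * (\sum_t q t * D t) * q s = \sum_t 2 * (q t * D t) * q s.
        by rewrite -mulr_suml -mulr_sumr.
      rewrite -big_split /=.
      by apply: eq_bigr => t _; ring.
    rewrite big_split /= -!mulr_sumr q1; ring.
  have -> : \sum_s q s * D s = 2 * (\sum_s q s) - 2 * \sum_s q s * (\sum_x g x * g (c - s - x)).
    rewrite !mulr_sumr -sumrB; apply: eq_bigr => s _; rewrite DE; ring.
  rewrite q1; ring.
by apply: ler_sum => s _; apply: ler_sum => t _; rewrite ler_wpM2l ?mulr_ge0.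
Qed.

End Reflections.

(** * Translations of the field with [p] elements *)

Section Prime.
Variables (R : realType) (p : nat) (p_pr : prime p).
Implicit Types (q g : 'F_p -> R) (c : 'F_p).

(** Triangle inequality in squared form. The induction uses [(A - C)^2 <= (1 + 1/n) (A - B)^2 + (1 +
    n) (B - C)^2], and [(1 + 1/n) n^2 + (1 + n) = (n + 1)^2]. *)
Lemma transl_mul_le g (a : 'F_p) k :
  \sum_x (g x - g (x + a *+ k)) ^+ 2 <= k%:R ^+ 2 * \sum_x (g x - g (x + a)) ^+ 2.
Proof.
elim: k => [|k IH].
  by rewrite mulr0n expr0n mul0r big1// => x _; rewrite addr0 subrr expr0n.
case: k IH => [|k] IH; first by rewrite mulr1n expr1n mul1r.
set n : R := k.+1%:R in IH *; have n0 : 0 < n by rewrite ltr0n.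
have -> : k.+2%:R = n + 1 by rewrite -natr1.
set S := \sum_x (g x - g (x + a)) ^+ 2 in IH *.
apply: (@le_trans _ _ ((1 + n^-1) * (n ^+ 2 * S) + (1 + n) * S)); last first.
  rewrite le_eqVlt; apply/orP; left; apply/eqP; field; exact: lt0r_neq0.
apply: (@le_trans _ _ ((1 + n^-1) * (\sum_x (g x - g (x + a *+ k.+1)) ^+ 2) +
   (1 + n) * S)); last by rewrite lerD2r ler_wpM2l// addr_ge0// invr_ge0 ltW.
rewrite /S -(sum_addr (fun x => (g x - g (x + a)) ^+ 2) (a *+ k.+1)).
rewrite !mulr_sumr -big_split /=; apply: ler_sum => x _.
rewrite mulrSr addrA -subr_ge0.
set A := g x; set B := g _; set C := g _.
have -> : (1 + n^-1) * (A - B) ^+ 2 + (1 + n) * (B - C) ^+ 2 - (A - C) ^+ 2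
   = n^-1 * ((A - B) - n * (B - C)) ^+ 2 by field; exact: lt0r_neq0.
by rewrite mulr_ge0 ?sqr_ge0 ?invr_ge0 ?ltW.
Qed.

(** The squared displacement averaged over all translations [b] is exactly [2 * defect g]. As [p] is
    prime, each [b] is a multiple of [a] with multiplier below [p], so it costs at most [p^2] times
    the displacement by [a]. *)
Lemma transl_ge g (a : 'F_p) : a != 0 -> \sum_x g x ^+ 2 = 1 ->
  2 * defect g <= p%:R ^+ 2 * \sum_x (g x - g (x + a)) ^+ 2.
Proof.
move=> a0 g1; have p0 : 0 < p%:R :> R by rewrite ltr0n prime_gt0.
rewrite -(ler_pM2l p0).
have <- : \sum_(b : 'F_p) \sum_x (g x - g (x + b)) ^+ 2 = p%:R * (2 * defect g).
  have E b : \sum_x (g x - g (x + b)) ^+ 2 = 2 - 2 * \sum_x g x * g (x + b).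
    have -> : \sum_x (g x - g (x + b)) ^+ 2 = \sum_x g x ^+ 2
      + \sum_x g (x + b) ^+ 2 - 2 * \sum_x g x * g (x + b).
      rewrite mulr_sumr -big_split -sumrB /=; apply: eq_bigr => x _; ring.
    by rewrite (sum_addr (fun x => g x ^+ 2)) g1.
  rewrite (eq_bigr _ (fun b _ => E b)) sumrB sumr_const card_Fp// -mulr_sumr.
  rewrite exchange_big /=.
  under eq_bigr => x _ do
    (rewrite -mulr_sumr; under eq_bigr => b _ do rewrite addrC; rewrite sum_addr).
  rewrite -mulr_suml /defect card_Fp// -mulr_natr; field; exact: lt0r_neq0.
have -> : p%:R * (p%:R ^+ 2 * \sum_x (g x - g (x + a)) ^+ 2) =
    \sum_(b : 'F_p) p%:R ^+ 2 * \sum_x (g x - g (x + a)) ^+ 2.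
  by rewrite sumr_const card_Fp// mulr_natl.
apply: ler_sum => b _.
have -> : b = a *+ (b / a : 'F_p).
  by rewrite -mulr_natr natr_Zp mulrCA divff ?mulr1.
apply: le_trans (transl_mul_le _ _ _) _.
rewrite ler_wpM2r ?sumr_ge0// => [x _|]; first exact: sqr_ge0.
rewrite ler_pXn2r ?nnegrE ?ler0n// ler_nat.
by apply: ltnW; rewrite -[X in (_ < X)%N]Fp_cast// ltn_ord.
Qed.

(** In [refl_mix_transl] the pairs [s != t] have total weight [1 - \sum_s q s ^+ 2], and [transl_ge]
    bounds the displacement of each from below. *)
Lemma refl_mix_le_gap q g c : (forall s, 0 <= q s) ->
  \sum_s q s = 1 -> \sum_x g x ^+ 2 = 1 ->
  \sum_s q s * (\sum_x g x * g (c - s - x)) <=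
    1 - (1 - \sum_s q s ^+ 2) * defect g / (4 * p%:R ^+ 2).
Proof.
move=> q0 q1 g1; have p0 : 0 < p%:R :> R by rewrite ltr0n prime_gt0.
have := refl_mix_transl c q0 q1 g1; set T := \sum_s q s * _ => H.
suff : (1 - \sum_s q s ^+ 2) * (2 * defect g / p%:R ^+ 2) <= 8 * (1 - T).
  have -> : (1 - \sum_s q s ^+ 2) * (2 * defect g / p%:R ^+ 2) =
     8 * ((1 - \sum_s q s ^+ 2) * defect g / (4 * p%:R ^+ 2)).
    by field; exact: lt0r_neq0.
  lra.
apply: le_trans H.
have -> : 1 - \sum_s q s ^+ 2 = \sum_s \sum_(t | t != s) q s * q t.
  rewrite -{1}(mulr1 1) -{1}q1 -{1}q1 mulr_suml -sumrB; apply: eq_bigr => s _.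
  by rewrite mulr_sumr (bigD1 s) //= expr2 addrAC subrr add0r.
rewrite mulr_suml; apply: ler_sum => s _.
have e0 : \sum_x (g x - g (x + (s - s))) ^+ 2 = 0.
  by apply: big1 => x _; rewrite subrr addr0 subrr expr0n.
rewrite [leRHS](bigD1 s) //= e0 mulr0 add0r.
rewrite mulr_suml; apply: ler_sum => t ts.
rewrite ler_wpM2l ?mulr_ge0// ler_pdivrMr ?exprn_gt0// [leRHS]mulrC.
by apply: transl_ge; rewrite // subr_eq0 eq_sym.
Qed.

End Prime.

(** * Young's inequality and its stability *)

Section YoungStability.
Variable R : realType.

(** The two coordinates carrying [g = sqrt q] contribute at most [\sum_s q s] by [sum_refl_le], so
    all [m.+2] terms of the AM-GM bound obey the same estimate. *)
Lemma csum_Young (G : finZmodType) m (q z : G -> R) :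
  (forall s, 0 <= q s) -> (forall s, 0 <= z s) ->
  (forall s, z s ^+ m.+2 = q s ^+ m.+1) ->
  csum (fun=> z) m.+2 0 <= (\sum_s q s) ^+ m.+1.
Proof.
move=> q0 z0 zq; pose g s := Num.sqrt (q s).
have gq s : g s ^+ 2 = q s by rewrite sqr_sqrtr.
have := csum_AGM q0 (fun s => sqrtr_ge0 (q s)) z0 gq zq.
have := @csum_le _ _ g q 0 m (\sum_s q s) q0 _ 0.
rewrite addn2 => /(_ _)/wrap[c|].
  by rewrite csum2; apply: le_trans (sum_refl_le _ _) _; under eq_bigr do rewrite gq.
rewrite -exprSr => T_le H.
have m0 : 0 < m.+2%:R :> R by rewrite ltr0n.
rewrite -(ler_pM2l m0); apply: le_trans H _.
have -> : m.+2%:R = m%:R + 2 :> R by rewrite -natrD addn2.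
rewrite [leRHS]mulrDl [leRHS]addrC lerD2r.
by rewrite ler_pM2l.
Qed.

Variables (p m : nat) (p_pr : prime p).
Variables (q z : 'F_p -> R).
Hypotheses (q0 : forall s, 0 <= q s) (q1 : \sum_s q s = 1).
Hypotheses (z0 : forall s, 0 <= z s) (zq : forall s, z s ^+ m.+3 = q s ^+ m.+2).

Let g s := Num.sqrt (q s).
Let gq s : g s ^+ 2 = q s. Proof. by rewrite sqr_sqrtr. Qed.
Let g1 : \sum_s g s ^+ 2 = 1.
Proof. by rewrite -q1; apply: eq_bigr => s _; rewrite gq. Qed.

(** Of the [m.+3] AM-GM terms only the two with [g] gain [e]. One coordinate weighted by [q] stays
    next to the pair to mix the reflections, hence at least three coordinates. *)
Lemma csum_le_mix (e : R) :
  (forall c, \sum_s q s * (\sum_x g x * g (c - s - x)) <= 1 - e) ->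
  csum (fun=> z) m.+3 0 <= 1 - 2 * e / m.+3%:R.
Proof.
move=> He.
have := csum_AGM q0 (fun s => sqrtr_ge0 (q s)) z0 gq zq.
have := @csum_le _ _ g q 1 m (1 - e) q0 _ 0.
rewrite q1 expr1n mul1r !addnS addn0 => /(_ _)/wrap[c|].
  rewrite csumS /=; apply: le_trans (He c); apply: ler_sum => s _.
  by rewrite csum2.
rewrite expr1n mulr1 => T_le H.
have m0 : 0 < m.+3%:R :> R by rewrite ltr0n.
rewrite -(ler_pM2l m0); apply: le_trans H _.
have -> : m.+3%:R * (1 - 2 * e / m.+3%:R) = m.+3%:R - 2 * e.
  by field; exact: lt0r_neq0.
have -> : m.+3%:R = m.+1%:R + 2 :> R by rewrite -natrD addn2.
lra.
Qed.

(** If [defect g] exceeds [1/32], the translation gap has order [delta / p^2]. Otherwise [g] is near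
    the constant unit vector, [q] is within [1/2] of uniform in L1, and the L1 estimate leaves at
    least half of the defect as gap. *)
Lemma csum_gap (delta B e : R) : 0 <= delta -> delta <= 1 ->
  (forall s, q s <= 1 - delta) -> B <= \sum_s (q s - p%:R^-1) ^+ 2 ->
  e <= p%:R * B / 36 -> e <= delta / (128 * p%:R ^+ 2) ->
  csum (fun=> z) m.+3 0 <= 1 - 2 * e / m.+3%:R.
Proof.
move=> d0 d1 qd qB eB ed; apply: csum_le_mix => c.
have p0 : 0 < p%:R :> R by rewrite ltr0n prime_gt0.
have p1 : 1 <= p%:R :> R by rewrite ler1n prime_gt0.
have g0 s : 0 <= g s by exact: sqrtr_ge0.
pose w : R := Num.sqrt p%:R^-1.
have w0 : 0 < w by rewrite sqrtr_gt0 invr_gt0.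
have w2 : w ^+ 2 = p%:R^-1 by rewrite sqr_sqrtr// invr_ge0 ltW.
have sw : \sum_(s : 'F_p) w ^+ 2 = 1.
  by rewrite sumr_const card_Fp// w2 -[LHS]mulr_natr mulVf// gt_eqF.
pose be := w * \sum_s g s.
have be0 : 0 <= be by rewrite mulr_ge0 ?(ltW w0) ?sumr_ge0.
pose V := \sum_s (g s - w) ^+ 2.
have VE : V = 2 - 2 * be.
  have -> : V = \sum_s g s ^+ 2 - 2 * (w * \sum_s g s) + \sum_(s : 'F_p) w ^+ 2.
    rewrite !mulr_sumr -sumrB -big_split /=; apply: eq_bigr => s _; ring.
  rewrite g1 sw /be; ring.
have WE : \sum_s (g s + w) ^+ 2 = 2 + 2 * be.
  transitivity (\sum_s g s ^+ 2 + 2 * (w * \sum_s g s) + \sum_(s : 'F_p) w ^+ 2).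
    rewrite !mulr_sumr -!big_split /=; apply: eq_bigr => s _; ring.
  rewrite g1 sw /be; ring.
have V0 : 0 <= V by apply: sumr_ge0 => s _; exact: sqr_ge0.
have hE : defect g = 1 - be ^+ 2 by rewrite /defect card_Fp// -w2 /be; ring.
have hV : V / 2 <= defect g by rewrite hE VE; nra.
have Vh : V <= 2 * defect g by rewrite hE VE; nra.
have h0 : 0 <= defect g by lra.
have sqw s : q s - p%:R^-1 = (g s - w) * (g s + w) by rewrite -gq -w2; ring.
have [hs|hl] := leP (defect g) (1 / 32); last first.
  apply: le_trans (refl_mix_le_gap p_pr c q0 q1 g1) _.
  rewrite lerD2l lerN2; apply: le_trans ed _.
  have -> : delta / (128 * p%:R ^+ 2) = delta * (1 / 32) / (4 * p%:R ^+ 2).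
    by field; exact: lt0r_neq0.
  rewrite ler_pM2r ?invr_gt0 ?mulr_gt0 ?exprn_gt0//.
  have dq : delta <= 1 - \sum_s q s ^+ 2.
    suff : \sum_s q s ^+ 2 <= \sum_s (1 - delta) * q s.
      by rewrite -mulr_sumr q1; lra.
    by apply: ler_sum => s _; rewrite expr2 ler_wpM2r.
  by rewrite ler_pM// ltW.
apply: le_trans (refl_mix_le_L1 c q1 g1) _.
rewrite lerD2l lerN2.
have L1 : \sum_s `|q s - #|'F_p|%:R^-1| <= 1 / 2.
  (* By AM-GM [|a b| <= 4 a^2 + b^2 / 16]; the first part sums to [4 V <= 1/4], the second to at
     most [1/4]. *)
  apply: (@le_trans _ _ (\sum_s (4 * (g s - w) ^+ 2 + (g s + w) ^+ 2 / 16))).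
    apply: ler_sum => s _; rewrite card_Fp// sqw normrM.
    rewrite -[X in X ^+ 2 / _]ger0_norm ?addr_ge0 ?(ltW w0)//.
    rewrite -[(g s - w) ^+ 2]real_normK ?num_real//.
    have := sqr_ge0 (8 * `|g s - w| - `|g s + w|).
    by rewrite expr2; nra.
  rewrite big_split /= -mulr_sumr -mulr_suml -/V WE; nra.
apply: (@le_trans _ _ (V / 4)); last by nra.
(* If every [q s <= 4/p], then [g s + w <= 3 w] and so [p B <= 9 V]. Otherwise a single [s] with
   [g s >= 2 w] already forces [V >= 1/p]. *)
have [/forallP qs|] := boolP [forall s, q s <= 4 / p%:R].
  apply: le_trans eB _; rewrite ler_pdivrMr// -mulrA.
  have : p%:R * B <= 9 * V; last by lra.
  rewrite -ler_pdivlMl//; apply: le_trans qB _.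
  rewrite /V mulrA mulr_sumr; apply: ler_sum => s _.
  rewrite sqw exprMn mulrC ler_wpM2r ?sqr_ge0// mulrC -w2.
  have gw : g s <= 2 * w.
    rewrite -(@ler_pXn2r _ 2) ?nnegrE ?mulr_ge0 ?(ltW w0)//.
    by rewrite gq exprMn w2; apply: le_trans (qs s) _; rewrite -natrX.
  have := g0 s; nra.
rewrite negb_forall => /existsP[s]; rewrite -ltNge => qs.
have gw : 2 * w <= g s.
  rewrite -(@ler_pXn2r _ 2) ?nnegrE ?mulr_ge0 ?(ltW w0)//.
  by rewrite gq exprMn w2; apply: ltW; apply: le_lt_trans qs; rewrite -natrX.
have Vw : w ^+ 2 <= V.
  rewrite /V (bigD1 s) //=.
  have : 0 <= \sum_(i | i != s) (g i - w) ^+ 2.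
    by apply: sumr_ge0 => i _; exact: sqr_ge0.
  nra.
apply: le_trans ed _.
apply: (@le_trans _ _ (w ^+ 2 / 4)); last by lra.
rewrite w2 ler_pdivrMr ?mulr_gt0 ?exprn_gt0//.
have -> : p%:R^-1 / 4 * (128 * p%:R ^+ 2) = 32 * p%:R :> R.
  by field; exact: lt0r_neq0.
nra.
Qed.

End YoungStability.

(** * Markov's inequality for the generating function *)

Section Probability.
Variables (disp : measure_display) (T : measurableType disp) (R : realType).
Variable P : probability T R.

Lemma probability_bigsetU_le (I : Type) (r : seq I) (Q : pred I) (F : I -> set T) :
  (forall i, Q i -> measurable (F i)) ->
  (P (\big[setU/set0]_(i <- r | Q i) F i) <= \sum_(i <- r | Q i) P (F i))%E.
Proof.
move=> mF; elim: r => [|i r IH]; first by rewrite !big_nil measure0.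
rewrite !big_cons; case: ifP => // Qi.
have mU : measurable (\big[setU/set0]_(j <- r | Q j) F j).
  exact: bigsetU_measurable.
by apply: le_trans (measureU2 _ (mF _ Qi) mU) _; rewrite leeD2l.
Qed.

Lemma measurable_tuple_nat1 (p : nat) (u : p.-tuple nat) :
  measurable [set u].
Proof.
rewrite (_ : [set u] = \bigcap_(j in [set: 'I_p]) (@tnth p nat ^~ j) @^-1` [set tnth u j]).
  apply: fin_bigcap_measurable => // j _; rewrite -[X in measurable X]setTI.
  exact: measurable_tnth.
apply/seteqP; split=> [_ -> //|v uv]; apply/eq_from_tnth => j.
exact: uv.
Qed.

(** The event is a finite union over the families of values with the right sums, and independence
    factors each piece. Weighting by [z] and dropping the constraint on the sums turns the total
    into an [n]-th power. *)
Lemma prob_sum_eq_le (n p d : nat) (U : seq (p.-tuple nat))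
    (X : 'I_n -> {RV P >-> p.-tuple nat}) (m : {ffun 'I_p -> 'I_n.+1})
    (z : nat -> R) :
  mutually_independent X -> (forall i, uniform_over (X i) U) ->
  (forall j, 0 <= z j) ->
  prob_sum_eq d X m * (\prod_(j < p) z j ^+ (d * m j)) * (size U)%:R ^+ n <=
  (\sum_(u <- U) \prod_(j < p) z j ^+ tnth u j) ^+ n.
Proof.
move=> indX unifX z0.
(* On the event every entry is at most [d * m j], hence at most [d * n], so finitely many value
   tuples suffice. *)
pose W := {ffun 'I_p -> 'I_(d * n).+1}.
pose tup (w : W) : p.-tuple nat := [tuple (w j : nat) | j < p].
pose c (w : W) : R := (count_mem (tup w) U)%:R / (size U)%:R.
pose Q (v : {ffun 'I_n -> W}) := [forall j, \sum_i v i j == d * m j]%N.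
pose A (v : {ffun 'I_n -> W}) :=
  \bigcap_(i in [set` [set: 'I_n]%SET]) (X i @^-1` [set tup (v i)]).
have mX i u : measurable (X i @^-1` [set u]).
  rewrite -[X in measurable X]setTI; apply: measurable_funP => //.
  exact: measurable_tuple_nat1.
have mA v : measurable (A v) by apply: fin_bigcap_measurable.
have PA v : P (A v) = (\prod_i c (v i))%:E.
  rewrite /A (indX [set: 'I_n]%SET (fun i => [set tup (v i)])); last first.
    by move=> i; exact: measurable_tuple_nat1.
  transitivity (\prod_i P (X i @^-1` [set tup (v i)]))%E.
    by apply: eq_bigl => i; rewrite finset.in_setT.
  rewrite (eq_bigr (fun i => (c (v i))%:E)) => [|i _]; last exact: unifX.
  by rewrite (big_morph EFin (@EFinM R) erefl).
pose E := [set t : T | forall j : 'I_p, (\sum_(i < n) tnth (X i t) j = d * m j)%N].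
have EA : E = \big[setU/set0]_(v | Q v) A v.
  apply/seteqP; split => t.
    move=> Et; rewrite -bigcup_seq_cond.
    have lt i j : (tnth (X i t) j < (d * n).+1)%N.
      rewrite ltnS; apply: (@leq_trans (d * m j)).
        by rewrite -Et (bigD1 i)//= leq_addr.
      by rewrite leq_mul2l -ltnS ltn_ord orbT.
    exists [ffun i => [ffun j => Ordinal (lt i j)]].
      rewrite /= mem_index_enum /=; apply/forallP => j; apply/eqP.
      by rewrite -(Et j); apply: eq_bigr => i _; rewrite !ffunE.
    move=> i _ /=; apply/eq_from_tnth => j.
    by rewrite tnth_mktuple !ffunE.
  rewrite -bigcup_seq_cond => -[v /= /andP[_ /forallP Qv] Av] j.
  rewrite -(eqP (Qv j)); apply: eq_bigr => i _.
  have -> : X i t = tup (v i) by apply: Av; rewrite /= finset.in_setT.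
  by rewrite tnth_mktuple.
have PE : prob_sum_eq d X m <= \sum_(v | Q v) \prod_i c (v i).
  rewrite -lee_fin /prob_sum_eq -/E fineK; last first.
    apply: fin_num_measure; rewrite EA; exact: bigsetU_measurable.
  rewrite EA -sumEFin; apply: le_trans (probability_bigsetU_le _ _) _ => //.
  by apply: lee_sum => v _; rewrite PA.
pose zz (w : W) := \prod_(j < p) z j ^+ w j.
have zz0 w : 0 <= zz w by apply: prodr_ge0 => j _; rewrite exprn_ge0.
apply: (@le_trans _ _ ((\sum_(v | Q v) \prod_i (c (v i) * zz (v i))) * (size U)%:R ^+ n)).
  rewrite ler_wpM2r ?exprn_ge0//.
  have zm0 : 0 <= \prod_(j < p) z j ^+ (d * m j).
    by apply: prodr_ge0 => j _; rewrite exprn_ge0.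
  apply: le_trans (ler_wpM2r zm0 PE) _.
  rewrite mulr_suml; apply: ler_sum => v /forallP Qv.
  rewrite [leRHS]big_split /= le_eqVlt; apply/orP; left; apply/eqP; congr (_ * _).
  rewrite exchange_big /=; apply: eq_bigr => j _.
  by rewrite -(eqP (Qv j)) expr_sum.
have c0 w : 0 <= c w by rewrite divr_ge0.
apply: (@le_trans _ _ ((\prod_(i < n) \sum_w (c w * zz w)) * (size U)%:R ^+ n)).
  rewrite ler_wpM2r ?exprn_ge0// bigA_distr_bigA /= [leRHS](bigID Q) /=.
  rewrite lerDl sumr_ge0// => v _; apply: prodr_ge0 => i _.
  by rewrite mulr_ge0.
rewrite prodr_const card_ord -exprMn; apply: lerXn2r; rewrite ?nnegrE.
- by rewrite mulr_ge0// sumr_ge0// => w _; rewrite mulr_ge0.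
- by apply: sumr_ge0 => u _; apply: prodr_ge0 => j _; rewrite exprn_ge0.
have [U0|Un0] := eqVneq (size U) 0.
  by rewrite U0 mulr0 sumr_ge0// => u _; apply: prodr_ge0 => j _; rewrite exprn_ge0.
have -> : (\sum_w c w * zz w) * (size U)%:R = \sum_w (count_mem (tup w) U)%:R * zz w.
  rewrite mulr_suml; apply: eq_bigr => w _; rewrite /c mulrAC divfK//.
  by rewrite pnatr_eq0.
have cE w : (count_mem (tup w) U)%:R = \sum_(u <- U) (u == tup w)%:R :> R.
  elim: U {unifX c PA PE c0 Un0} => [|u U IH]; first by rewrite big_nil.
  by rewrite /= natrD IH big_cons.
under eq_bigr => w _ do rewrite cE mulr_suml.
rewrite exchange_big /=; apply: ler_sum => u _.
have tup_inj : injective tup.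
  move=> w w' /(congr1 (fun x => tnth x)) ww; apply/ffunP => j; apply: val_inj.
  by have := congr1 (@^~ j) ww; rewrite /= !tnth_mktuple.
case: (pickP (fun w => u == tup w)) => [w0 /eqP ->|nw]; last first.
  rewrite big1 ?prodr_ge0// => [j _|w _]; first by rewrite exprn_ge0.
  by rewrite nw mul0r.
rewrite (bigD1 w0) //= eqxx mul1r big1 ?addr0 => [|w ww0].
  by rewrite /zz; under [leRHS]eq_bigr => j _ do rewrite tnth_mktuple.
by rewrite (inj_eq tup_inj) eq_sym (negPf ww0) mul0r.
Qed.

End Probability.

(** * The generating function of the multiset of count vectors *)

Section Counting.
Variables (R : realType) (p d : nat) (p_pr : prime p).

Lemma sum_multisetU (z : nat -> R) :
  \sum_(u <- multisetU d p) \prod_(j < p) z j ^+ tnth u j =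
  csum (fun _ (a : 'F_p) => z a) d 0.
Proof.
rewrite /multisetU big_image /=; apply: eq_bigr => x _.
have lt i : (x 0%R i < p)%N by rewrite -[X in (_ < X)%N]Fp_cast// ltn_ord.
rewrite [RHS](partition_big (fun i => Ordinal (lt i)) xpredT) //=.
apply: eq_bigr => j _; rewrite tnth_mktuple -prodr_const.
apply: eq_big => [i|i]; rewrite finset.inE -?val_eqE//=.
by move=> /eqP <-.
Qed.

Lemma size_multisetU : (0 < d)%N ->
  (size (multisetU d p))%:R = p%:R ^+ d.-1 :> R.
Proof.
move=> d0; rewrite -sum1_size natr_sum.
rewrite (eq_bigr (fun u => \prod_(j < p) 1 ^+ tnth u j)) => [|u _]; last first.
  by rewrite big1// => j _; rewrite expr1n.
rewrite (sum_multisetU (fun=> 1)).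
rewrite (csum_free _ d0)// (eq_bigr (fun=> p%:R)) => [|i _]; last first.
  by rewrite sumr_const card_Fp//.
rewrite (eq_bigl (fun l => l \in predC1 (Ordinal d0))) => [|l]; last first.
  by rewrite inE -val_eqE.
by rewrite prodr_const cardC1 card_ord.
Qed.

Variables (disp : measure_display) (T : measurableType disp).
Variables (P : probability T R) (n : nat) (X : 'I_n -> {RV P >-> p.-tuple nat}).
Hypotheses (indX : mutually_independent X).
Hypotheses (unifX : forall i, uniform_over (X i) (multisetU d p)).
Implicit Types m : {ffun 'I_p -> 'I_n.+1}.

Lemma prob_sum_eq_ge0 m : 0 <= prob_sum_eq d X m.
Proof. exact: fine_ge0. Qed.

Lemma prob_le_csum m (z : nat -> R) : (0 < d)%N -> (forall j, 0 <= z j) ->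
  prob_sum_eq d X m * (\prod_(j < p) z j ^+ (d * m j)) * (p ^ (d.-1 * n))%:R <=
  csum (fun _ (a : 'F_p) => z a) d 0 ^+ n.
Proof.
move=> d0 z0; have := prob_sum_eq_le d m indX unifX z0.
by rewrite sum_multisetU size_multisetU// -exprM -natrX.
Qed.

(** A zero-sum row is not constantly [j], since [p] divides neither [d] nor [j], so [j] occurs at
    most [d - 1] times per row. In analytic form, weight [M] at [j] and 1 elsewhere give
    [prob * M <= 1] for every [M >= 1]. *)
Lemma prob_sum_eq0 m (j : 'I_p) : (0 < d)%N -> ~~ (p %| d)%N -> j != 0%N :> nat ->
  (d.-1 * n < d * m j)%N -> prob_sum_eq d X m = 0.
Proof.
move=> d0 pd j0 mj; have p0 : 0 < p%:R :> R by rewrite ltr0n prime_gt0.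
have HM (M : R) : 1 <= M -> prob_sum_eq d X m * M <= 1.
  move=> M1; have M0 : 0 <= M by exact: le_trans M1.
  pose z (k : nat) : R := if k == j then M else 1.
  have z0 k : 0 <= z k by rewrite /z; case: ifP.
  have z1 k : z k <= M by rewrite /z; case: ifP.
  have Fle : csum (fun _ (a : 'F_p) => z a) d 0 <= p%:R ^+ d.-1 * M ^+ d.-1.
    rewrite -size_multisetU// /multisetU size_image -sum1_card natr_sum mulr_suml.
    apply: ler_sum => x /eqP x0; rewrite mul1r.
    have [i xi] : exists i, x 0 i != j :> nat.
      apply/existsP; rewrite -negb_forall; apply/negP => /forallP xj.
      move/eqP: x0; rewrite (eq_bigr (fun=> (j%:R : 'F_p))) => [|i _]; last first.
        by rewrite -(eqP (xj i)) natr_Zp.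
      rewrite sumr_const card_ord -mulrnA -(dvdn_pcharf (pchar_Fp p_pr)).
      rewrite Euclid_dvdM// (negPf pd) orbF => /dvdn_leq.
      by rewrite lt0n j0 leqNgt ltn_ord => /(_ isT).
    rewrite (bigD1 i) //= {1}/z (negPf xi) mul1r.
    apply: (@le_trans _ _ (\prod_(k | k != i) M)).
      by apply: ler_prod => k _; rewrite z0 z1.
    by rewrite prodr_const cardC1 card_ord.
  have := prob_le_csum m d0 z0; rewrite (bigD1 j) //= {1}/z eqxx.
  rewrite big1 ?mulr1 => [|k kj]; last first.
    by rewrite /z val_eqE (negPf kj) expr1n.
  have := @lerXn2r _ n _ _ _ _ Fle; rewrite !nnegrE csum_ge0// => /(_ isT).
  rewrite mulr_ge0 ?exprn_ge0 ?(ltW p0)// => /(_ isT) F2 F1.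
  have {F1 F2} := le_trans F1 F2.
  rewrite natrX exprMn -!exprM [leRHS]mulrC ler_pM2r ?exprn_gt0// => H.
  rewrite -(@ler_pM2r _ (M ^+ (d.-1 * n))) ?exprn_gt0 ?(lt_le_trans ltr01)//.
  rewrite mul1r -mulrA -exprS; apply: le_trans H.
  by rewrite ler_wpM2l ?prob_sum_eq_ge0// ler_weXn2l.
have [pr0|pr0] := leP (prob_sum_eq d X m) 0.
  by apply/eqP; rewrite eq_le pr0 prob_sum_eq_ge0.
(* [M = 1 + 1 / prob] would give [prob + 1 <= 1]. *)
have := HM (1 + (prob_sum_eq d X m)^-1); rewrite lerDl invr_ge0 (ltW pr0).
by rewrite mulrDr divff ?gt_eqF// mulr1 => /(_ isT); lra.
Qed.

End Counting.

(** * Rows in the sparse regime *)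

Section SparseRows.
Variables (R : realType) (G : finZmodType).

(* A nonzero row with zero sum has at least two nonzero coordinates, so each
   such row contributes a factor [sg ^+ 2]. *)
Lemma csum_sparse_le m (sg : R) (q y : G -> R) : 0 <= sg <= 1 ->
  (forall s, 0 <= q s) -> (forall s, 0 <= y s) ->
  (forall s, y s ^+ m.+2 = q s ^+ m.+1) -> y 0 = 1 ->
  csum (fun _ a => if a == 0 then 1 else sg * y a) m.+2 0 <=
    1 + sg ^+ 2 * (\sum_s q s) ^+ m.+1.
Proof.
move=> /andP[sg0 sg1] q0 y0 yq y01.
apply: (@le_trans _ _ (1 + sg ^+ 2 * csum (fun=> y) m.+2 0)); last first.
  by rewrite lerD2l ler_wpM2l ?exprn_ge0//; exact: csum_Young.
rewrite {1}/csum (bigD1 (0 : 'rV[G]_m.+2)) /=; last first.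
  by apply/eqP; apply: big1 => i _; rewrite mxE.
apply: lerD.
  by rewrite big1// => i _; rewrite mxE eqxx.
rewrite /csum mulr_sumr [leRHS](bigD1 (0 : 'rV[G]_m.+2)) /=; last first.
  by apply/eqP; apply: big1 => i _; rewrite mxE.
rewrite -[leLHS]add0r lerD ?mulr_ge0 ?exprn_ge0 ?prodr_ge0//.
apply: ler_sum => x /andP[/eqP sx x0].
have [i xi] : exists i, x 0 i != 0.
  apply/existsP; rewrite -negb_forall; apply: contra x0 => /forallP x0.
  by apply/eqP/rowP => i; rewrite mxE (eqP (x0 i)).
have [i' /andP[ii' xi']] : exists i', (i' != i) && (x 0 i' != 0).
  apply/existsP; rewrite -[X in is_true X]negbK negb_exists; apply/negP => /forallP H.
  move: sx; rewrite (bigD1 i) //= big1 ?addr0 => [/eqP|k ki]; first by apply/negP.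
  by have := H k; rewrite ki /= negbK => /eqP.
pose c (a : G) : R := if a == 0 then 1 else sg.
have -> : \prod_(i < m.+2) (if x 0 i == 0 then 1 else sg * y (x 0 i)) =
    (\prod_(i < m.+2) c (x 0 i)) * \prod_(i < m.+2) y (x 0 i).
  rewrite -big_split /=; apply: eq_bigr => k _; rewrite /c.
  by case: eqP => [->|_]; rewrite ?y01 ?mulr1.
rewrite ler_wpM2r ?prodr_ge0// (bigD1 i) //= (bigD1 i') //= {1 2}/c.
rewrite (negPf xi) (negPf xi') mulrA -expr2 ler_piMr ?exprn_ge0//.
by apply: prodr_ile1 => k; rewrite /c; case: ifP; rewrite ?ler01 ?lexx ?sg0.
Qed.

End SparseRows.

(** * Elementary Stirling bounds *)

Section Factorials.
Variable R : realType.
Implicit Types m n d k : nat.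
Let E : R := expR 1.
Let E1 : 1 <= E. Proof. by rewrite -expR0 ler_expR. Qed.
Let E0 : 0 < E. Proof. exact: expR_gt0. Qed.

(** Induction with [(1 + 1/n)^n <= e]. *)
Lemma expn_fact_le m : m%:R ^+ m <= m`!%:R * E ^+ m :> R.
Proof.
elim: m => [|m IH]; first by rewrite !expr0 fact0 mulr1.
case: m IH => [|m] IH; first by rewrite (_ : 1`! = 1%N)// mul1r !expr1.
set n : R := m.+1%:R in IH *; have n0 : 0 < n by rewrite ltr0n.
have nS : m.+2%:R = n + 1 :> R by rewrite -natr1.
have -> : m.+2`!%:R * E ^+ m.+2 = (n + 1) * (E * (m.+1`!%:R * E ^+ m.+1)).
  by rewrite factS natrM nS [E ^+ m.+2]exprS; ring.
have -> : m.+2%:R ^+ m.+2 = (n + 1) * ((1 + n^-1) ^+ m.+1 * n ^+ m.+1).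
  have e : (1 + n^-1) * n = n + 1 by field; exact: lt0r_neq0.
  by rewrite nS exprS -exprMn e.
rewrite ler_pM2l ?addr_gt0// ler_pM ?exprn_ge0 ?addr_ge0 ?invr_ge0 ?(ltW n0)//.
apply: (@le_trans _ _ (expR n^-1 ^+ m.+1)).
  by apply: lerXn2r; rewrite ?nnegrE ?addr_ge0 ?invr_ge0 ?(ltW n0) ?expR_ge0 ?expR_ge1Dx.
by rewrite -expRM_natr -/n mulVf ?lt0r_neq0.
Qed.

(** Induction with [(1 - 1/(n+1))^(n+1) <= 1/e]. *)
Lemma fact_expn_le m : (0 < m)%N -> m`!%:R * E ^+ m <= E * m%:R * m%:R ^+ m :> R.
Proof.
case: m => // m _; elim: m => [|m IH]; first by rewrite (_ : 1`! = 1%N)// !expr1 mul1r !mulr1.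
set n : R := m.+1%:R in IH *; have n0 : 0 < n by rewrite ltr0n.
have nS : m.+2%:R = n + 1 :> R by rewrite -natr1.
have n1 : 0 < n + 1 by rewrite addr_gt0.
rewrite factS natrM nS exprS.
apply: (@le_trans _ _ ((n + 1) * E * (E * n * n ^+ m.+1))).
  have -> : (n + 1) * m.+1`!%:R * (E * E ^+ m.+1) =
    (n + 1) * E * (m.+1`!%:R * E ^+ m.+1) by ring.
  by rewrite ler_pM2l ?mulr_gt0.
have -> : (n + 1) * E * (E * n * n ^+ m.+1) = E * (n + 1) * (E * n ^+ m.+2).
  by rewrite [n ^+ m.+2]exprS; ring.
rewrite ler_pM2l ?mulr_gt0//.
have -> : n ^+ m.+2 = (1 - (n + 1)^-1) ^+ m.+2 * (n + 1) ^+ m.+2.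
  rewrite -exprMn; congr (_ ^+ _); field; exact: lt0r_neq0.
rewrite mulrA -[leRHS]mul1r ler_pM2r ?exprn_gt0//.
apply: (@le_trans _ _ (E * expR (- (n + 1)^-1) ^+ m.+2)).
  rewrite ler_pM2l//; apply: lerXn2r; rewrite ?nnegrE ?expR_ge0 ?expR_ge1Dx//.
  by rewrite subr_ge0 invf_le1// lerDr ltW.
rewrite -expRM_natr nS mulNr mulVf ?gt_eqF// /E -expRD subrr expR0//.
Qed.

End Factorials.

(** * The coefficient of the probability: dense bound *)

Section Coefficients.
Variable R : realType.
Let E : R := expR 1.
Let E1 : 1 <= E. Proof. by rewrite -expR0 ler_expR. Qed.
Let E0 : 0 < E. Proof. exact: expR_gt0. Qed.

Section MulFact.
Variable d : nat.
Let D : R := d.+1%:R.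
(** By Stirling, [(d.+1 * m)!] is [rho^m m^(d m) m!] up to a polynomial factor. *)
Let rho : R := D ^+ d.+1 / E ^+ d.
Let D1 : 1 <= D. Proof. by rewrite ler1n. Qed.
Let D0 : 0 < D. Proof. by rewrite ltr0n. Qed.
Let rhoE m : rho ^+ m * E ^+ (d.+1 * m) = D ^+ (d.+1 * m) * E ^+ m.
Proof.
rewrite [(d.+1 * m)%N in LHS]mulSn exprD mulrCA [RHS]mulrC; congr (_ * _).
by rewrite expr_div_n -!exprM divfK// expf_neq0// gt_eqF.
Qed.

(** The prefactor involves [n] instead of [m] so that it is common to all parts; it also covers
    [m = 0], where [fact_expn_le] does not apply. *)
Lemma fact_mul_le n m : (0 < n)%N -> (m <= n)%N ->
  (d.+1 * m)`!%:R <= (E * D * n%:R) * (rho ^+ m * m%:R ^+ (d * m) * m`!%:R).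
Proof.
move=> n0 mn; have n1 : 1 <= n%:R :> R by rewrite ler1n.
have [->|m0] := posnP m.
  rewrite !muln0 fact0 !expr0 !mulr1; apply: mulr_ege1 => //.
  exact: mulr_ege1.
rewrite -(@ler_pM2r _ (E ^+ (d.+1 * m))) ?exprn_gt0//.
apply: le_trans (fact_expn_le R _) _; first by rewrite muln_gt0.
have -> : E * D * n%:R * (rho ^+ m * m%:R ^+ (d * m) * m`!%:R) * E ^+ (d.+1 * m)
  = (E * (D * n%:R)) * (D ^+ (d.+1 * m) * m%:R ^+ (d * m) * (m`!%:R * E ^+ m)).
  transitivity (E * (D * n%:R) * (m%:R ^+ (d * m) * m`!%:R * (rho ^+ m * E ^+ (d.+1 * m)))).
    ring.
  rewrite rhoE; ring.
rewrite natrM exprMn ler_pM ?mulr_ge0 ?exprn_ge0 ?(ltW E0) ?(ltW D0)//.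
  by rewrite ler_pM2l// ler_pM2l// ler_nat.
rewrite -[leRHS]mulrA ler_pM2l ?exprn_gt0// mulSn exprD mulrC.
by rewrite ler_wpM2l ?exprn_ge0// expn_fact_le.
Qed.

Lemma fact_mul_ge n : (0 < n)%N ->
  n`!%:R * (rho ^+ n * n%:R ^+ (d * n)) <= E * n%:R * (d.+1 * n)`!%:R.
Proof.
move=> n0; rewrite -(@ler_pM2r _ (E ^+ (d.+1 * n))) ?exprn_gt0//.
have -> : n`!%:R * (rho ^+ n * n%:R ^+ (d * n)) * E ^+ (d.+1 * n) =
  (n`!%:R * E ^+ n) * (D ^+ (d.+1 * n) * n%:R ^+ (d * n)).
  transitivity (n`!%:R * n%:R ^+ (d * n) * (rho ^+ n * E ^+ (d.+1 * n))); first ring.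
  rewrite rhoE; ring.
apply: (@le_trans _ _ (E * n%:R * n%:R ^+ n * (D ^+ (d.+1 * n) * n%:R ^+ (d * n)))).
  by rewrite ler_wpM2r ?mulr_ge0 ?exprn_ge0 ?(ltW D0)// fact_expn_le.
have -> : E * n%:R * n%:R ^+ n * (D ^+ (d.+1 * n) * n%:R ^+ (d * n)) =
   E * n%:R * (d.+1 * n)%:R ^+ (d.+1 * n).
  rewrite natrM exprMn -/D [in RHS](mulSn d n) [n%:R ^+ (_ + _)]exprD mulSn; ring.
rewrite -[leRHS]mulrA ler_pM2l ?mulr_gt0 ?ltr0n//.
exact: expn_fact_le.
Qed.

End MulFact.

Variables (p d n : nat) (m : {ffun 'I_p -> 'I_n.+1}).
Hypothesis sm : (\sum_j m j = n)%N.

Definition coef : R :=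
  multinomial R m * ((\prod_(j < p) (d.+1 * m j)`!%:R) / (d.+1 * n)`!%:R).

Let fact0 k : 0 < k`!%:R :> R. Proof. by rewrite ltr0n fact_gt0. Qed.

(** The powers of [rho] cancel because the parts sum to [n], and the factorials of the parts cancel
    against the multinomial. One polynomial factor is lost per part and one for [(d.+1 * n)!]. *)
Lemma coef_dense_le : (0 < n)%N ->
  coef <= (E * d.+1%:R * n%:R) ^+ p.+1 *
          \prod_(j < p) ((m j)%:R / n%:R) ^+ (d * m j).
Proof.
move=> n0; have nR0 : 0 < n%:R :> R by rewrite ltr0n.
set K := E * d.+1%:R * n%:R; have K0 : 0 <= K by rewrite !mulr_ge0// ltW.
pose rho : R := d.+1%:R ^+ d.+1 / E ^+ d.
have rho0 : 0 <= rho by rewrite divr_ge0 ?exprn_ge0 ?(ltW E0).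
have num : \prod_(j < p) (d.+1 * m j)`!%:R <= K ^+ p *
    (rho ^+ n * \prod_(j < p) (m j)%:R ^+ (d * m j) * \prod_(j < p) (m j)`!%:R) :> R.
  apply: (@le_trans _ _ (\prod_(j < p)
      (K * (rho ^+ m j * (m j)%:R ^+ (d * m j) * (m j)`!%:R)))).
    apply: ler_prod => j _; rewrite ler0n /=.
    by apply: fact_mul_le; rewrite // -ltnS ltn_ord.
  by rewrite big_split prodr_const card_ord !big_split /= -expr_sum sm.
have den := fact_mul_ge d n0; rewrite -/rho in den.
rewrite /coef /multinomial.
have -> : \prod_(j < p) ((m j)%:R / n%:R) ^+ (d * m j) =
   (\prod_(j < p) (m j)%:R ^+ (d * m j)) / n%:R ^+ (d * n) :> R.
  under eq_bigr => j _ do rewrite expr_div_n.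
  rewrite big_split /= prodfV; congr (_ / _).
  by rewrite -expr_sum -big_distrr /= sm.
set A := \prod_(j < p) (m j)%:R ^+ (d * m j) in num *.
set B := \prod_(j < p) (m j)`!%:R in num *.
set C := \prod_(j < p) _ in num *.
have B0 : 0 < B by apply: prodr_gt0.
have A0 : 0 <= A by apply: prodr_ge0 => j _; rewrite exprn_ge0.
rewrite mulf_div ler_pdivrMr ?mulr_gt0// [X in _ <= X * _]mulrA [leRHS]mulrAC.
rewrite ler_pdivlMr ?exprn_gt0//.
apply: (@le_trans _ _ (n`!%:R * (K ^+ p * (rho ^+ n * A * B)) * n%:R ^+ (d * n))).
  by rewrite ler_wpM2r ?exprn_ge0 ?(ltW nR0)// ler_wpM2l ?(ltW (fact0 _)).
have -> : n`!%:R * (K ^+ p * (rho ^+ n * A * B)) * n%:R ^+ (d * n) =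
  (K ^+ p * A * B) * (n`!%:R * (rho ^+ n * n%:R ^+ (d * n))) by ring.
have -> : K ^+ p.+1 * A * (B * (d.+1 * n)`!%:R) = (K ^+ p * A * B) * (K * (d.+1 * n)`!%:R).
  by rewrite exprSr; ring.
rewrite ler_wpM2l ?mulr_ge0 ?exprn_ge0 ?(ltW B0)//; apply: le_trans den _.
rewrite ler_wpM2r ?(ltW (fact0 _))// /K -mulrA ler_pM2l// ler_peMl ?ler1n//.
Qed.

End Coefficients.

(** * The coefficient of the probability: sparse bound *)

Section SparseCoefficient.

Lemma leq_expl a b e : (a <= b)%N -> (a ^ e <= b ^ e)%N.
Proof. by case: e => // e ab; rewrite leq_exp2r. Qed.

Lemma fact_add_le a k : ((a + k)`! <= a`! * (a + k) ^ k)%N.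
Proof.
elim: k => [|k IH]; first by rewrite addn0 muln1.
rewrite addnS factS expnS mulnCA leq_mul2l /=; apply: leq_trans IH _.
by rewrite leq_mul2l leq_expl ?orbT.
Qed.

Lemma fact_add_ge a k : (a`! * a ^ k <= (a + k)`!)%N.
Proof.
elim: k => [|k IH]; first by rewrite addn0 muln1.
rewrite addnS factS expnS mulnCA leq_mul//.
by rewrite ltnW// ltnS leq_addr.
Qed.

Variables (R : realType) (p d n : nat) (m : {ffun 'I_p -> 'I_n.+1}) (o : 'I_p).
Hypotheses (sm : (\sum_j m j = n)%N) (d0 : (0 < d)%N) (mo : (n <= 2 * m o)%N).
Let k := (n - m o)%N.

(** Ratios over the large part use powers of [n], with no polynomial loss per part:
    [n! / (m o)! <= n^k], and [(d.+1 * n)! / (d.+1 * m o)! >= n^(d.+1 * k)] because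
    [d.+1 * m o >= 2 * m o >= n]. *)
Lemma coef_sparse_le : (0 < n)%N -> coef R d m <=
  (n%:R ^+ (d * k))^-1 * \prod_(j < p | j != o) (d.+1 * m j)%:R ^+ (d * m j).
Proof.
move=> n0; rewrite /coef /multinomial.
have f0 a : 0 < a`!%:R :> R by rewrite ltr0n fact_gt0.
have P0 : 0 < \prod_(j < p) (m j)`!%:R :> R by apply: prodr_gt0.
rewrite mulf_div ler_pdivrMr ?mulr_gt0// -mulrA ler_pdivlMl; last first.
  by rewrite exprn_gt0 ?ltr0n.
rewrite (bigD1 o) //= [\prod_(j < p) (m j)`!%:R](bigD1 o) //=.
have -> : \prod_(j < p | j != o) (d.+1 * m j)%:R ^+ (d * m j) =
    (\prod_(j < p | j != o) (d.+1 * m j) ^ (d * m j))%N%:R :> R.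
  by rewrite natr_prod; apply: eq_bigr => j _; rewrite natrX.
rewrite -!natr_prod -natrX -!natrM ler_nat.
have mn : (m o <= n)%N by rewrite -ltnS.
have nE : (n = m o + k)%N by rewrite subnKC.
set A := (\prod_(j < p | j != o) (d.+1 * m j)`!)%N.
set B := (\prod_(j < p | j != o) (m j)`!)%N.
set C := (\prod_(j < p | j != o) (d.+1 * m j) ^ (d * m j))%N.
have AB : (A <= B * C)%N.
  rewrite /A /B /C -big_split /=; apply: leq_prod => j _.
  by rewrite mulSn; exact: fact_add_le.
have h1 : (n`! <= (m o)`! * n ^ k)%N by have := fact_add_le (m o) k; rewrite -nE.
have h2 : ((d.+1 * m o)`! * n ^ (d.+1 * k) <= (d.+1 * n)`!)%N.
  have -> : (d.+1 * n = d.+1 * m o + d.+1 * k)%N by rewrite -mulnDr -nE.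
  apply: leq_trans (fact_add_ge _ _).
  rewrite leq_mul2l; apply/orP; right; apply: leq_expl; nia.
apply: (@leq_trans (n ^ (d * k) * ((m o)`! * n ^ k) * ((d.+1 * m o)`! * (B * C)))).
  rewrite -mulnA leq_mul2l; apply/orP; right.
  by rewrite leq_mul// leq_mul2l AB orbT.
have -> : (n ^ (d * k) * ((m o)`! * n ^ k) * ((d.+1 * m o)`! * (B * C)) =
  ((d.+1 * m o)`! * n ^ (d.+1 * k)) * ((m o)`! * (B * C)))%N.
  rewrite mulSn expnD; ring.
apply: (@leq_trans ((d.+1 * n)`! * ((m o)`! * (B * C)))).
  by rewrite leq_mul2r h2 orbT.
by rewrite leq_eqVlt; apply/orP; left; apply/eqP; ring.
Qed.
End SparseCoefficient.

(** * Bounds on a single summand *)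

Section Terms.
Variables (R : realType) (p k n : nat) (p_pr : prime p).
Variables (disp : measure_display) (T : measurableType disp).
Variables (P : probability T R) (X : 'I_n -> {RV P >-> p.-tuple nat}).
Hypotheses (indX : mutually_independent X).
Hypotheses (unifX : forall i, uniform_over (X i) (multisetU k.+3 p)).
Variable m : {ffun 'I_p -> 'I_n.+1}.
Hypotheses (sm : (\sum_j m j = n)%N) (n0 : (0 < n)%N).

Definition term : R :=
  multinomial R m
  * ((p ^ (k.+2 * n))%:R * (\prod_(j < p) (k.+3 * m j)`!%:R) / (k.+3 * n)`!%:R)
  * prob_sum_eq k.+3 X m.

Let nR0 : 0 < n%:R :> R. Proof. by rewrite ltr0n. Qed.

(** Extension by zero, so that one weight on naturals serves both ['I_p] and ['F_p]. *)
Let mm (j : nat) : nat := if insub j is Some i then m (i : 'I_p) else 0%N.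
Let mmE (j : 'I_p) : mm j = m j.
Proof. by rewrite /mm valK. Qed.

Lemma sum_Fp (f : nat -> R) : \sum_(a : 'F_p) f a = \sum_(j < p) f j.
Proof. by rewrite -!(big_mkord xpredT) Fp_cast. Qed.

(** The power [x^((d-1)/d)] with [d = k.+3]. *)
Definition frac_pow (x : R) : R := (x `^ k.+3%:R^-1) ^+ k.+2.

Lemma frac_pow_ge0 x : 0 <= frac_pow x.
Proof. by rewrite exprn_ge0// powR_ge0. Qed.

Lemma frac_powE x : 0 <= x -> frac_pow x ^+ k.+3 = x ^+ k.+2.
Proof.
move=> x0; rewrite /frac_pow exprAC; congr (_ ^+ _).
by rewrite -powR_mulrn ?powR_ge0// -powRrM mulVf ?powRr1// pnatr_eq0.
Qed.

Lemma term_le (z : nat -> R) (K : R) : 0 <= K -> (forall j, 0 <= z j) ->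
  coef R k.+2 m <= K * \prod_(j < p) z j ^+ (k.+3 * m j) ->
  term <= K * csum (fun _ (a : 'F_p) => z a) k.+3 0 ^+ n.
Proof.
move=> K0 z0 cle; set pr := prob_sum_eq k.+3 X m.
have pr0 : 0 <= pr by exact: prob_sum_eq_ge0.
have -> : term = coef R k.+2 m * ((p ^ (k.+2 * n))%:R * pr).
  by rewrite /term /coef -/pr; ring.
apply: (@le_trans _ _ (K * (\prod_(j < p) z j ^+ (k.+3 * m j))
   * ((p ^ (k.+2 * n))%:R * pr))).
  by rewrite ler_wpM2r// mulr_ge0.
rewrite -mulrA ler_wpM2l//.
have := prob_le_csum p_pr indX unifX m (ltn0Sn _) z0; rewrite -/pr.
by apply: le_trans; rewrite le_eqVlt; apply/orP; left; apply/eqP => /=; ring.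
Qed.

(** With [q j = m j / n] and weights [frac_pow (q j)], the denominator in Markov's inequality is
    exactly the product in [coef_dense_le], and [csum_gap] bounds the numerator. *)
Lemma term_dense_le (delta B e : R) : 0 <= delta -> delta <= 1 ->
  (forall j, (m j)%:R / n%:R <= 1 - delta) ->
  B <= \sum_(j < p) ((m j)%:R / n%:R - p%:R^-1) ^+ 2 ->
  e <= p%:R * B / 36 -> e <= delta / (128 * p%:R ^+ 2) ->
  term <= (expR 1 * k.+3%:R * n%:R) ^+ p.+1 * (1 - 2 * e / k.+3%:R) ^+ n.
Proof.
move=> d0 d1 md mB eB ed.
pose q (j : nat) : R := (mm j)%:R / n%:R.
have q0 j : 0 <= q j by rewrite divr_ge0.
pose z j := frac_pow (q j); have z0 j : 0 <= z j by exact: frac_pow_ge0.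
set K := (_ * _) ^+ _; have K0 : 0 <= K.
  by rewrite exprn_ge0// !mulr_ge0// expR_ge0.
apply: (@le_trans _ _ (K * csum (fun _ (a : 'F_p) => z a) k.+3 0 ^+ n)).
  apply: term_le => //; apply: le_trans (coef_dense_le R k.+2 sm n0) _.
  rewrite ler_wpM2l// le_eqVlt; apply/orP; left; apply/eqP.
  by apply: eq_bigr => j _; rewrite [RHS]exprM /z frac_powE ?q0// -exprM /q mmE.
have Fle : csum (fun _ (a : 'F_p) => z a) k.+3 0 <= 1 - 2 * e / k.+3%:R.
  apply: (csum_gap p_pr (q := fun a : 'F_p => q a) _ _ _ _ d0 d1 _ _ eB ed) => //.
  - rewrite (sum_Fp q) /q -mulr_suml -natr_sum.
    by under eq_bigr do rewrite mmE; rewrite sm divff ?gt_eqF.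
  - by move=> s; rewrite frac_powE.
  - move=> s; rewrite /q /mm; case: insubP => [j _ _|_]; first exact: md.
    by rewrite mul0r subr_ge0.
  - rewrite (sum_Fp (fun j => (q j - p%:R^-1) ^+ 2)).
    by under eq_bigr do rewrite /q mmE.
rewrite ler_wpM2l//; apply: lerXn2r; rewrite ?nnegrE ?csum_ge0//.
by apply: le_trans Fle; exact: csum_ge0.
Qed.

(** With [d = k.+3], the power [d^(d-1)] comes from the coefficient, the exponential from
    [(1 + 2^(d-1) r / n)^n <= exp(2^(d-1) r)]. *)
Definition sparse_const : R := k.+3%:R ^+ k.+2 * expR (2 ^+ k.+2).

Lemma term_sparse_le (o : 'I_p) : o = 0%N :> nat -> (n <= 2 * m o)%N ->
  (m o < n)%N ->
  term <= (sparse_const * Num.sqrt ((n - m o)%:R / n%:R)) ^+ (n - m o).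
Proof.
move=> o0 mo mon; set r := (n - m o)%N; have r0 : (0 < r)%N by rewrite subn_gt0.
have rR0 : 0 < r%:R :> R by rewrite ltr0n.
set sg := Num.sqrt _.
have sg2 : sg ^+ 2 = r%:R / n%:R by rewrite sqr_sqrtr// divr_ge0.
have sg0 : 0 <= sg by exact: sqrtr_ge0.
have sg1 : sg <= 1.
  rewrite -(@expr_le1 _ 2)// sg2 ler_pdivrMr// mul1r ler_nat; exact: leq_subr.
have sr : (\sum_(j < p | j != o) m j = r)%N.
  by have := sm; rewrite (bigD1 o) //= => /(canRL (addKn _)).
have pw (x : R) c : x ^+ (c * r) = \prod_(j < p | j != o) x ^+ (c * m j).
  by rewrite -sr big_distrr /= expr_sum.
(* Mass 1 at 0 makes [y 0 = 1]; the other entries [m j / r] also have total mass 1. The total 2 is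
   the source of [2^(d-1)]. *)
pose q (j : nat) : R := if j == 0%N then 1 else (mm j)%:R / r%:R.
have q0 j : 0 <= q j by rewrite /q; case: ifP => // _; rewrite divr_ge0.
pose y j := frac_pow (q j); have y0 j : 0 <= y j by exact: frac_pow_ge0.
pose z j := if j == 0%N then 1 else sg * y j.
have z0 j : 0 <= z j by rewrite /z; case: ifP => // _; rewrite mulr_ge0.
(* The coefficient supplies [sg^(2 (d-1) r)] and the weights use up [sg^(d r)]. What remains is
   [sg^((d-2) r)], and [d - 2 >= 1] is where [d >= 3] enters. *)
pose K := (k.+3%:R ^+ k.+2 * sg ^+ k.+1) ^+ r.
have K0 : 0 <= K by rewrite exprn_ge0// mulr_ge0 ?exprn_ge0.
have jo (j : 'I_p) : j != o -> (j : nat) != 0%N by rewrite -o0.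
apply: (@le_trans _ _ (K * csum (fun _ (a : 'F_p) => z a) k.+3 0 ^+ n)).
  apply: term_le => //; apply: le_trans (coef_sparse_le R sm _ mo n0) _ => //.
  rewrite -/r le_eqVlt; apply/orP; left; apply/eqP.
  rewrite [in RHS](bigD1 o) //= {1}/z o0 eqxx expr1n mul1r.
  have -> : \prod_(j < p | j != o) z j ^+ (k.+3 * m j) = sg ^+ (k.+3 * r) *
      (\prod_(j < p | j != o) (m j)%:R ^+ (k.+2 * m j) / r%:R ^+ (k.+2 * r)).
    rewrite !pw -prodfV -!big_split /=.
    apply: eq_bigr => j /jo /negPf j0.
    rewrite /z j0 exprMn; congr (_ * _); rewrite [in LHS]exprM /y frac_powE// -exprM.
    by rewrite /q j0 mmE expr_div_n.
  have -> : \prod_(j < p | j != o) (k.+3 * m j)%:R ^+ (k.+2 * m j) =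
     k.+3%:R ^+ (k.+2 * r) * \prod_(j < p | j != o) (m j)%:R ^+ (k.+2 * m j) :> R.
    rewrite pw -big_split /=.
    by apply: eq_bigr => j _; rewrite natrM exprMn.
  have e : sg ^+ (2 * (k.+2 * r)) = r%:R ^+ (k.+2 * r) / n%:R ^+ (k.+2 * r).
    by rewrite exprM sg2 expr_div_n.
  have e2 : K * sg ^+ (k.+3 * r) = k.+3%:R ^+ (k.+2 * r) * sg ^+ (2 * (k.+2 * r)).
    rewrite /K exprMn -!exprM -mulrA -exprD; congr (_ * sg ^+ _); lia.
  rewrite [RHS]mulrA e2 e; field.
  by rewrite !expf_neq0// gt_eqF.
have -> : (sparse_const * sg) ^+ r = (k.+3%:R ^+ k.+2 * sg) ^+ r * expR (2 ^+ k.+2 * r%:R).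
  by rewrite expRM_natr -exprMn /sparse_const; congr (_ ^+ _); ring.
apply: ler_pM => //; first by rewrite exprn_ge0// csum_ge0.
  have D0 : 0 <= k.+3%:R ^+ k.+2 :> R by exact: exprn_ge0.
  apply: lerXn2r; rewrite ?nnegrE.
  - exact: mulr_ge0 D0 (exprn_ge0 _ sg0).
  - exact: mulr_ge0 D0 sg0.
  - apply: (ler_wpM2l D0); rewrite -[leRHS]expr1.
    exact: ler_wiXn2l.
have -> : 2 ^+ k.+2 * r%:R = (sg ^+ 2 * 2 ^+ k.+2) * n%:R.
  by rewrite sg2; field; exact: lt0r_neq0.
rewrite expRM_natr; apply: lerXn2r; rewrite ?nnegrE ?csum_ge0 ?expR_ge0//.
apply: le_trans (expR_ge1Dx _).
have sq : \sum_(a : 'F_p) q a = 2.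
  rewrite sum_Fp (bigD1 o) //= {1}/q o0 eqxx.
  rewrite (eq_bigr (fun j => (m j)%:R / r%:R)) => [|j /jo /negPf j0].
    by rewrite -mulr_suml -natr_sum sr divff ?gt_eqF.
  by rewrite /q j0 mmE.
rewrite -sq; have := @csum_sparse_le R 'F_p k.+1 sg (fun a => q a) (fun a => y a).
rewrite sg0 sg1 => /(_ isT _ _ _ _)/wrap[| | | |].
- by move=> s; exact: q0.
- by move=> s; exact: y0.
- by move=> s; rewrite frac_powE.
- by rewrite /y /q /frac_pow /= powR1 expr1n.
exact.
Qed.

End Terms.

(** * Summation over compositions *)

Section Compositions.
Variable R : realType.

Lemma geometric_sum_le (th : R) n : 0 <= th -> th <= 1 / 2 ->
  \sum_(i < n.+1) th ^+ i <= 1 + 2 * th.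
Proof.
move=> th0 th2; have S2 N : \sum_(i < N) th ^+ i <= 2.
  elim: N => [|N IH]; first by rewrite big_ord0.
  rewrite big_ord_recl; under eq_bigr do rewrite exprS.
  by rewrite -mulr_sumr /=; nra.
rewrite big_ord_recl expr0 lerD2l; under eq_bigr do rewrite exprS.
by rewrite -mulr_sumr mulrC ler_wpM2r.
Qed.

(** The part at [o] is determined by the others, so the sum embeds into a product of geometric sums;
    the [- 1] removes the all-zero tuple, excluded by [m o < n]. *)
Lemma sum_compositions_le (p n : nat) (o : 'I_p) (th : R) :
  0 <= th -> th <= 1 / 2 ->
  \sum_(m : {ffun 'I_p -> 'I_n.+1} | (\sum_j m j == n)%N && (m o < n)%N)
    th ^+ (n - m o) <= (1 + 2 * th) ^+ p - 1.
Proof.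
move=> th0 th2.
pose f (j : 'I_p) (i : 'I_n.+1) : R := if j == o then (i == ord0)%:R else th ^+ i.
pose F (y : {ffun 'I_p -> 'I_n.+1}) := \prod_j f j (y j).
have F0 y : 0 <= F y.
  by apply: prodr_ge0 => j _; rewrite /f; case: ifP => _; rewrite ?exprn_ge0.
pose phi (m : {ffun 'I_p -> 'I_n.+1}) : {ffun 'I_p -> 'I_n.+1} :=
  [ffun j => if j == o then ord0 else m j].
pose A := [set m : {ffun 'I_p -> 'I_n.+1} | (\sum_j m j == n)%N && (m o < n)%N]%SET.
have sub m : m \in A -> (\sum_(j | j != o) m j = n - m o)%N.
  by rewrite finset.inE => /andP[/eqP + _]; rewrite (bigD1 o) //= => /(canRL (addKn _)).
have phiF m : m \in A -> th ^+ (n - m o) = F (phi m).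
  move=> mA; rewrite -sub// expr_sum /F [RHS](bigD1 o) //= /f /phi ffunE eqxx eqxx mul1r.
  by apply: eq_bigr => j /negPf jo; rewrite jo ffunE jo.
have phi_inj : {in A &, injective phi}.
  move=> m m' mA mA' e; have e' j : j != o -> m j = m' j.
    by move=> /negPf jo; have := congr1 (fun g : {ffun _} => g j) e; rewrite !ffunE jo.
  apply/ffunP => j; have [->|/e'//] := eqVneq j o.
  apply: val_inj => /=; move: (mA) (mA'); rewrite !finset.inE.
  move=> /andP[/eqP s _] /andP[/eqP s' _]; move: s; rewrite -[RHS]s'.
  rewrite (bigD1 o) //= [RHS](bigD1 o) //=.
  by rewrite (eq_bigr (fun i => m' i : nat)) => [/addIn|i /e' ->].
rewrite (eq_bigl (fun m => m \in A)) => [|m]; last by rewrite finset.inE.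
rewrite (eq_bigr _ phiF) -(big_imset F phi_inj) /= lerBrDl.
pose z : {ffun 'I_p -> 'I_n.+1} := [ffun=> ord0].
have Fz : F z = 1.
  by apply: big1 => j _; rewrite /f /z ffunE eqxx expr0; case: ifP.
have nz y : y \in phi @: A -> y != z.
  move=> /imsetP[m mA ->]; apply/eqP => e.
  have : (\sum_(j | j != o) m j = 0)%N.
    apply: big1 => j /negPf jo; have := congr1 (fun g : {ffun _} => g j) e.
    by rewrite !ffunE jo => ->.
  rewrite sub// => e0; move: mA.
  by rewrite finset.inE -subn_gt0 e0 andbF.
apply: (@le_trans _ _ (\sum_y F y)).
  rewrite [leRHS](bigD1 z) //= Fz lerD2l [leRHS](bigID (mem (phi @: A)%SET)) /=.
  rewrite (eq_bigl (fun y => (y != z) && (y \in (phi @: A)%SET))) => [|y].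
    by rewrite lerDl; apply: sumr_ge0.
  by case: (boolP (y \in _)) => [/nz ->|]; rewrite ?andbF.
rewrite /F -bigA_distr_bigA /= -[X in _ ^+ X]card_ord -prodr_const.
apply: ler_prod => j _; apply/andP; split.
  by apply: sumr_ge0 => i _; rewrite /f; case: ifP => _; rewrite ?exprn_ge0.
rewrite /f; case: eqP => _; last exact: geometric_sum_le.
rewrite (bigD1 ord0) //= big1 => [|i /negPf ->//]; rewrite ?eqxx addr0 lerDl.
exact: mulr_ge0.
Qed.

End Compositions.

(** * The full sum for fixed [n] *)

Section FiniteBound.
Variables (R : realType) (p k n : nat) (p_pr : prime p).
Variables (disp : measure_display) (T : measurableType disp).
Variables (P : probability T R) (X : 'I_n -> {RV P >-> p.-tuple nat}).
Hypotheses (indX : mutually_independent X).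
Hypotheses (unifX : forall i, uniform_over (X i) (multisetU k.+3 p)).

Variable C : R.
Hypothesis CE : C = sparse_const R k.
(** The threshold for [r / n] in the sparse regime, chosen so that [C * sqrt delta = 1/16]. *)
Let delta : R := (16 * C) ^- 2.
(** The base of the sparse bound at [r = p]. *)
Let theta : R := C * Num.sqrt (p%:R / n%:R).

Lemma sparse_const_ge : k.+3%:R <= C.
Proof.
rewrite CE /sparse_const -[leLHS]mulr1; apply: ler_pM => //.
  by rewrite -[leLHS]expr1 ler_weXn2l// ler1n.
by rewrite -expR0 ler_expR exprn_ge0.
Qed.

Hypotheses (pk : (k.+3 < p)%N) (n2 : (2 <= n)%N).
Hypothesis En : expR 1 * k.+3%:R <= n%:R :> R.
Hypothesis p3n : p%:R ^+ 3 * ln n%:R / n%:R <= delta / (384 * k.+3%:R).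
Hypothesis theta2 : theta <= 1 / 2.

Lemma sum_term_ge0 (b : R) : 0 <= \sum_(m in calN b n p) term k X m.
Proof.
apply: sumr_ge0 => m _; rewrite /term /multinomial.
by rewrite !mulr_ge0 ?invr_ge0 ?prodr_ge0 ?prob_sum_eq_ge0.
Qed.

(** The three terms account for sparse tuples with [r <= p], sparse tuples with [r > p], and dense
    tuples. *)
Lemma sum_term_le (b : R) : 108 * k.+3%:R <= b ->
  \sum_(m in calN b n p) term k X m <=
  ((1 + 2 * theta) ^+ p - 1) + (5 / 8) ^+ p + n%:R^-1.
Proof.
move=> hb; pose o : 'I_p := Ordinal (prime_gt0 p_pr).
have n0 : (0 < n)%N by exact: leq_trans n2.
have nR0 : 0 < n%:R :> R by rewrite ltr0n.
have pR0 : 0 < p%:R :> R by rewrite ltr0n prime_gt0.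
have D3 : 3 <= k.+3%:R :> R by rewrite ler_nat.
have CD := sparse_const_ge.
have C1 : 1 <= C by lra.
have C0 : 0 < C by lra.
have C16 : 0 < 16 * C by rewrite mulr_gt0.
have del0 : 0 < delta by rewrite invr_gt0 exprn_gt0.
have delD : delta * k.+3%:R <= 1.
  rewrite /delta mulrC ler_pdivrMr ?(exprn_gt0 _ C16)// mul1r expr2; nra.
have del2 : delta <= 1 / 2.
  have : delta * 3 <= delta * k.+3%:R by rewrite ler_pM2l.
  by move: delD; lra.
have theta0 : 0 <= theta by rewrite mulr_ge0 ?sqrtr_ge0 ?(ltW C0).
pose near (m : {ffun 'I_p -> 'I_n.+1}) := (n - m o)%:R <= delta * n%:R.
have inN (m : {ffun 'I_p -> 'I_n.+1}) : m \in calN b n p ->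
  [/\ (\sum_j m j)%N = n, (m o < n)%N &
   b * ln n%:R / n%:R <= \sum_(j < p) ((m j)%:R / n%:R - p%:R^-1) ^+ 2].
  rewrite finset.inE => /and3P[/eqP sm ne /ltW h]; split=> //.
  rewrite ltn_neqAle -[X in _ && X]ltnS ltn_ord andbT; apply: contra ne => /eqP mo.
  apply/forallP => j; have [j0|j0] := eqVneq (j : nat) 0%N.
    by rewrite (_ : j = o) ?mo//; exact: val_inj.
  have := sm; rewrite (bigD1 o) //= mo => /(canRL (addKn _)); rewrite subnn.
  by move=> /eqP; rewrite sum_nat_eq0 => /forallP/(_ j); rewrite -val_eqE /= j0 => /= ->.
(* For [r <= p] the base is at most [theta]. For [r > p] it is at most [1/16 = 1/2 * 1/8], where
   [(1/2)^r <= (1/2)^p] and the powers of [1/8] remain for the summation. *)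
have near_le (m : {ffun 'I_p -> 'I_n.+1}) : m \in calN b n p -> near m ->
    term k X m <= theta ^+ (n - m o) + (1 / 2) ^+ p * (1 / 8) ^+ (n - m o).
  move=> /inN[sm mo _] nm; set r := (n - m o)%N in nm *.
  have mo2 : (n <= 2 * m o)%N.
    suff : (2 * r <= n)%N by rewrite mulnBr leq_subLR mul2n -addnn leq_add2r.
    rewrite -(ler_nat R) natrM; have := ler_wpM2r (ltW nR0) del2.
    by move: nm; rewrite /near -/r; lra.
  apply: le_trans (term_sparse_le p_pr indX unifX sm n0 (erefl : o = 0%N :> nat) mo2 mo) _.
  rewrite -/r -CE; have [rp|pr] := leqP r p.
    rewrite -[leLHS]addr0 lerD ?mulr_ge0 ?exprn_ge0//; apply: lerXn2r.
    - by rewrite nnegrE mulr_ge0 ?sqrtr_ge0 ?(ltW C0).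
    - by rewrite nnegrE.
    - rewrite ler_pM2l// ler_sqrt ?divr_ge0// ler_pM2r ?invr_gt0// ler_nat//.
  rewrite -[leLHS]add0r lerD ?exprn_ge0//.
  apply: (@le_trans _ _ ((1 / 16) ^+ r)).
    apply: lerXn2r; rewrite ?nnegrE ?mulr_ge0 ?sqrtr_ge0 ?(ltW C0)//.
    rewrite -ler_pdivlMl// -[leRHS]ger0_norm ?mulr_ge0 ?invr_ge0 ?(ltW C0)//.
    rewrite -sqrtr_sqr ler_wsqrtr// ler_pdivrMr//; apply: le_trans nm _.
    have -> : (C^-1 * (1 / 16)) ^+ 2 = delta by rewrite /delta; field; exact: lt0r_neq0.
    by rewrite ler_pM2r.
  have -> : (1 / 16) ^+ r = (1 / 2) ^+ r * (1 / 8) ^+ r :> R.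
    by rewrite -exprMn; congr (_ ^+ _); field.
  rewrite ler_wpM2r ?exprn_ge0// ler_wiXn2l//; first lra.
  exact: ltnW.
have ln0 : 0 <= ln n%:R :> R by rewrite ln_ge0// ler1n.
(* Chosen so that [exp(-2 e n / d) = n^(-6 p)]. One condition on [e] in [term_dense_le] then follows
   from [b >= 108 d], the other from [p3n], with [384 = 3 * 128]. *)
pose e : R := 3 * k.+3%:R * p%:R * ln n%:R / n%:R.
have far_le (m : {ffun 'I_p -> 'I_n.+1}) : m \in calN b n p -> ~~ near m ->
    term k X m <= (expR 1 * k.+3%:R * n%:R) ^+ p.+1 * expR (- (6 * p%:R * ln n%:R)).
  move=> /inN[sm mo hB]; rewrite /near -ltNge => fm.
  have K0 : 0 <= (expR 1 * k.+3%:R * n%:R : R) ^+ p.+1 * expR (- (6 * p%:R * ln n%:R)).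
    by rewrite mulr_ge0 ?expR_ge0// exprn_ge0// !mulr_ge0 ?expR_ge0.
  (* If a part with [j != 0] exceeds [(1 - 1/d) n], the probability is zero. Otherwise all parts are
     at most [(1 - delta) n]: for [j != 0] since [delta * d <= 1], for [j = 0] since the tuple is
     not near. *)
  have [/existsP[j /andP[j0 mj]]|] :=
      boolP [exists j : 'I_p, (j != 0%N :> nat) && (k.+2 * n < k.+3 * m j)%N].
    rewrite /term (prob_sum_eq0 p_pr indX unifX _ _ j0)// ?mulr0//.
    by apply/negP => /(dvdn_leq (ltn0Sn _)); rewrite leqNgt pk.
  rewrite negb_exists => /forallP mj.
  have he : e <= delta / (128 * p%:R ^+ 2).
    rewrite ler_pdivlMr ?mulr_gt0 ?exprn_gt0//.
    have -> : e * (128 * p%:R ^+ 2) = (p%:R ^+ 3 * ln n%:R / n%:R) * (384 * k.+3%:R).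
      by rewrite /e; field; exact: lt0r_neq0.
    have c0 : 0 < 384 * k.+3%:R :> R by rewrite mulr_gt0 ?ltr0n.
    by rewrite -(ler_pdivlMr _ _ c0).
  apply: le_trans (term_dense_le p_pr indX unifX sm n0 (delta := delta) (e := e)
     (ltW del0) _ _ hB _ he) _.
  - lra.
  - move=> j; rewrite ler_pdivrMr//; have [jo|jo] := eqVneq j o.
      have mon : (m o)%:R + (n - m o)%:R = n%:R :> R by rewrite -natrD subnKC// ltnW.
      by rewrite jo; nra.
    have := mj j; rewrite (_ : j != 0%N :> nat)//= -leqNgt -(ler_nat R) !natrM => h.
    have k3 : k.+3%:R = k.+2%:R + 1 :> R by rewrite natr1.
    rewrite -(@ler_pM2l _ k.+3%:R) ?ltr0n//; apply: le_trans h _; nra.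
  - rewrite /e; have -> : p%:R * (b * ln n%:R / n%:R) / 36 =
      (b / 36) * p%:R * ln n%:R / n%:R by field; exact: lt0r_neq0.
    do 3 (rewrite ler_wpM2r ?invr_ge0 ?(ltW nR0) ?(ltW pR0) ?ln0//).
    lra.
  rewrite ler_wpM2l ?exprn_ge0 ?mulr_ge0 ?expR_ge0//.
  have -> : - (6 * p%:R * ln n%:R) = (- (2 * e / k.+3%:R)) * n%:R.
    by rewrite /e; field; rewrite !lt0r_neq0// ltr0n.
  have eD : 2 * e / k.+3%:R <= 1.
    rewrite ler_pdivrMr ?ltr0n// mul1r.
    suff : e <= 1 by lra.
    apply: le_trans he _; rewrite ler_pdivrMr ?mulr_gt0 ?exprn_gt0// mul1r.
    have : 1 <= p%:R ^+ 2 :> R by rewrite exprn_ege1// ler1n prime_gt0.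
    lra.
  rewrite expRM_natr; apply: lerXn2r; rewrite ?nnegrE ?expR_ge0 ?subr_ge0//.
  exact: expR_ge1Dx.
rewrite (bigID near) /=; apply: lerD.
  apply: (@le_trans _ _ (\sum_(m : {ffun 'I_p -> 'I_n.+1} | (\sum_j m j == n)%N && (m o < n)%N)
      (theta ^+ (n - m o) + (1 / 2) ^+ p * (1 / 8) ^+ (n - m o)))).
    rewrite big_mkcond [leRHS]big_mkcond /=; apply: ler_sum => m _.
    case: ifP => [/andP[mN nm]|_].
      by have [sm mo _] := inN _ mN; rewrite sm eqxx mo /= near_le.
    by case: ifP => // _; rewrite addr_ge0 ?mulr_ge0 ?exprn_ge0.
  rewrite big_split /= lerD//; first exact: sum_compositions_le.
  rewrite -mulr_sumr.
  have -> : (5 / 8) ^+ p = (1 / 2) ^+ p * (1 + 2 * (1 / 8)) ^+ p :> R.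
    by rewrite -exprMn; congr (_ ^+ _); field.
  rewrite ler_wpM2l ?exprn_ge0//.
  apply: le_trans (@sum_compositions_le R p n o (1 / 8) _ _) _; lra.
apply: (@le_trans _ _ (\sum_(m : {ffun 'I_p -> 'I_n.+1})
   (expR 1 * k.+3%:R * n%:R) ^+ p.+1 * expR (- (6 * p%:R * ln n%:R)))).
  rewrite big_mkcond /=; apply: ler_sum => m _.
  case: ifP => [/andP[mN nm]|_]; first exact: far_le.
  by rewrite mulr_ge0 ?expR_ge0// exprn_ge0// !mulr_ge0 ?expR_ge0.
rewrite sumr_const card_ffun !card_ord -[leLHS]mulr_natl natrX.
have -> : expR (- (6 * p%:R * ln n%:R)) = (n%:R ^+ (6 * p))^-1 :> R.
  have -> : 6 * p%:R * ln n%:R = ln n%:R * (6 * p)%:R :> R by rewrite natrM mulrC.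
  by rewrite expRN expRM_natr lnK ?posrE.
rewrite mulrA ler_pdivrMr ?exprn_gt0//.
have p4 : (4 <= p)%N by apply: leq_ltn_trans pk.
(* The [(n+1)^p] tuples and the factor [(e d n)^(p+1)] cost at most [n^(4 p + 2)], which is at most
   [n^(6 p - 1)]. *)
apply: (@le_trans _ _ ((n%:R ^+ 2) ^+ p * (n%:R ^+ 2) ^+ p.+1)).
  apply: ler_pM; rewrite ?exprn_ge0// ?mulr_ge0 ?expR_ge0//.
    apply: lerXn2r; rewrite ?nnegrE ?exprn_ge0// -natrX ler_nat expnS expn1.
    apply: (@leq_trans (2 * n)); last by rewrite leq_mul2r n2 orbT.
    by rewrite mul2n -addnn -addn1 leq_add2l.
  apply: lerXn2r; rewrite ?nnegrE ?exprn_ge0// ?mulr_ge0 ?expR_ge0//.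
  by rewrite expr2 ler_pM2r.
rewrite -!exprM -exprD.
have -> : (6 * p = (6 * p).-1.+1)%N by clear -p4; lia.
rewrite exprS mulKf ?gt_eqF// ler_weXn2l ?ler1n//.
by clear -p4; lia.
Qed.

End FiniteBound.

(** * Asymptotics in [n] and the limit *)

Lemma cube_growth (R : realType) (eps : R) (p : nat -> nat) : 0 < eps ->
  (\forall n \near \oo, (p n)%:R <= (n%:R : R) `^ (3%:R^-1 - eps)) ->
  forall c : R, 0 < c -> \forall n \near \oo,
    (p n)%:R ^+ 3 / n%:R <= c /\ (p n)%:R ^+ 3 * ln n%:R / n%:R <= c.
Proof.
(* Since [p^3 / n <= n^(-3 eps)] and [log n <= n^eps / eps], both quantities are at most
   [(1 + 1/eps) n^(-a)], which is at most [c] once [n >= M]. *)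
move=> eps0 pn c c0; pose a := 2 * eps.
pose M : R := (c^-1 * (1 + eps^-1)) `^ a^-1.
have a0 : 0 < a by rewrite mulr_gt0.
near=> n.
have n1 : (1 <= n)%N by near: n; exact: nbhs_infty_ge.
have nR : 1 <= n%:R :> R by rewrite ler1n.
have nR0 : 0 < n%:R :> R by rewrite ltr0n.
have nM : M <= n%:R by near: n; exact: nbhs_infty_ger.
have pnn : (p n)%:R <= (n%:R : R) `^ (3%:R^-1 - eps) by near: n.
have nx x : 0 < n%:R `^ x :> R by rewrite powR_gt0.
have ca : (1 + eps^-1) * n%:R `^ (- a) <= c.
  rewrite powRN ler_pdivrMr// -ler_pdivrMl//.
  have -> : c^-1 * (1 + eps^-1) = M `^ a.
    by rewrite -powRrM mulVf ?gt_eqF// powRr1// mulr_ge0 ?addr_ge0 ?invr_ge0 ?ltW.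
  apply: (ge0_ler_powR (ltW a0)) nM; rewrite nnegrE; first exact: powR_ge0.
  exact: ltW.
have p3 : (p n)%:R ^+ 3 / n%:R <= n%:R `^ (- (3 * eps)) :> R.
  rewrite ler_pdivrMr//.
  have -> : n%:R `^ (- (3 * eps)) * n%:R = (n%:R `^ (3%:R^-1 - eps)) ^+ 3 :> R.
    rewrite -powR_mulrn ?powR_ge0// -powRrM -[X in _ * X]powRr1// -powRD; last first.
      by apply/implyP => _; rewrite gt_eqF.
    by congr (_ `^ _); field.
  by apply: lerXn2r; rewrite ?nnegrE.
have lnn : ln n%:R <= eps^-1 * n%:R `^ eps :> R.
  rewrite ler_pdivlMl// -ln_powR; exact: ltW (ln_sublinear _).
have p3a : (p n)%:R ^+ 3 / n%:R <= n%:R `^ (- a) :> R.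
  by apply: le_trans p3 _; apply: ler_powR => //; rewrite /a; lra.
have e0 : 0 < eps^-1 by rewrite invr_gt0.
split; first by apply: le_trans p3a _; apply: le_trans ca; rewrite ler_peMl ?lerDl ?ltW.
rewrite mulrAC; apply: (@le_trans _ _ (n%:R `^ (- (3 * eps)) * (eps^-1 * n%:R `^ eps))).
  by apply: ler_pM; rewrite // ?divr_ge0// ln_ge0.
rewrite mulrCA -powRD; last by apply/implyP => _; rewrite gt_eqF.
apply: le_trans ca; rewrite (_ : - (3 * eps) + eps = - a); last by rewrite /a; ring.
by rewrite ler_wpM2r ?powR_ge0// lerDr.
Unshelve. all: by end_near. Qed.

Theorem proposition2p4 (R : realType) (d : nat) (hd : (3 <= d)%N) :
  exists2 eps0 : R, 0 < eps0 &
  forall eps : R, 0 < eps -> eps <= eps0 ->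
  exists2 b0 : R, 0 < b0 &
  forall b : R, b0 <= b ->
  forall (p : nat -> nat),
    (forall n : nat, prime (p n)) ->
    p n @[n --> \oo] --> \oo ->
    (\forall n \near \oo, (p n)%:R <= (n%:R : R) `^ (3%:R^-1 - eps)) ->
  forall (disp : nat -> measure_display)
         (T : forall n : nat, measurableType (disp n))
         (P : forall n : nat, probability (T n) R)
         (X : forall n : nat, 'I_n -> {RV (P n) >-> (p n).-tuple nat}),
    (forall n : nat, mutually_independent (X n)) ->
    (forall (n : nat) (i : 'I_n), uniform_over (X n i) (multisetU d (p n))) ->
  \sum_(m in calN b n (p n))
     (multinomial R m
      * ((p n ^ ((d - 1) * n))%:R * (\prod_(j < p n) (d * m j)`!%:R)
         / (d * n)`!%:R)
      * prob_sum_eq d (X n) m)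
    @[n --> \oo] --> (0 : R).
Proof.
exists 1 => // eps eps0 _; exists (108 * d%:R) => [|b hb p p_pr p_oo p_le].
  by rewrite mulr_gt0// ltr0n (leq_trans _ hd).
case: d hd hb => [|[|[|k]]]// _ hb disp T P X indX unifX.
rewrite subn1 /=; under eq_fun do rewrite -/(term k (X _) _).
have [C CE] : {C | C = sparse_const R k} by exists (sparse_const R k).
have CD : k.+3%:R <= C := sparse_const_ge CE.
have C0 : 0 < C by apply: lt_le_trans CD; rewrite ltr0n.
have delta0 : 0 < (16 * C) ^- 2 / (384 * k.+3%:R).
  by rewrite divr_gt0 ?invr_gt0 ?exprn_gt0 ?mulr_gt0 ?ltr0n.
apply/cvgr0Pnorm_le => e e0.
(* [(1 + 2 theta)^p <= exp(2 theta p)], and this is at most [1 + e/3] when [2 theta p <= x0]. *)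
pose x0 := ln (1 + e / 3).
have x00 : 0 < x0 by rewrite ln_gt0// ltrDl divr_gt0.
have c10 : 0 < (x0 / (2 * C)) ^+ 2 by rewrite exprn_gt0// divr_gt0// mulr_gt0.
have c20 : 0 < (1 / (2 * C)) ^+ 2 by rewrite exprn_gt0// divr_gt0// mulr_gt0.
have geo : (5 / 8 : R) ^+ p n @[n --> \oo] --> (0 : R).
  apply: (cvg_comp _ _ p_oo); apply: cvg_expr; rewrite ger0_norm//; lra.
have p_gt : \forall n \near \oo, (k.+3 < p n)%N := p_oo _ (nbhs_infty_gt k.+3).
have e3 : 0 < e / 3 by rewrite divr_gt0.
near=> n.
have pn : prime (p n) := p_pr n.
have pk : (k.+3 < p n)%N by near: n.
have n2 : (2 <= n)%N by near: n; exact: nbhs_infty_ge.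
have nR0 : 0 < n%:R :> R by rewrite ltr0n (leq_trans _ n2).
have En : expR 1 * k.+3%:R <= n%:R :> R by near: n; exact: nbhs_infty_ger.
have ne : 3 / e <= n%:R by near: n; exact: nbhs_infty_ger.
have [_ p3n] : (p n)%:R ^+ 3 / n%:R <= (16 * C) ^- 2 / (384 * k.+3%:R) /\
    (p n)%:R ^+ 3 * ln n%:R / n%:R <= (16 * C) ^- 2 / (384 * k.+3%:R).
  by near: n; exact: (cube_growth eps0 p_le delta0).
have [h1 _] : (p n)%:R ^+ 3 / n%:R <= (x0 / (2 * C)) ^+ 2 /\
    (p n)%:R ^+ 3 * ln n%:R / n%:R <= (x0 / (2 * C)) ^+ 2.
  by near: n; exact: (cube_growth eps0 p_le c10).
have [h2 _] : (p n)%:R ^+ 3 / n%:R <= (1 / (2 * C)) ^+ 2 /\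
    (p n)%:R ^+ 3 * ln n%:R / n%:R <= (1 / (2 * C)) ^+ 2.
  by near: n; exact: (cube_growth eps0 p_le c20).
have h3 : (5 / 8 : R) ^+ p n <= e / 3.
  near: n; have /cvgr0Pnorm_le/(_ _ e3) := geo; apply: filterS => n.
  by apply: le_trans; exact: ler_norm.
rewrite ger0_norm; last exact: sum_term_ge0.
pose s : R := Num.sqrt ((p n)%:R / n%:R).
(* The cube enters here: both smallness conditions on [C * s] reduce to a bound on [p^3 / n]. *)
have sp : s * (p n)%:R = Num.sqrt ((p n)%:R ^+ 3 / n%:R).
  rewrite -[X in _ * X]ger0_norm// -sqrtr_sqr -sqrtrM ?divr_ge0//.
  by congr Num.sqrt; ring.
have s0 : 0 <= s by exact: sqrtr_ge0.
have spl : s <= s * (p n)%:R by rewrite ler_peMr// ler1n prime_gt0.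
have sq y : 0 <= y -> (p n)%:R ^+ 3 / n%:R <= y ^+ 2 -> s * (p n)%:R <= y.
  by move=> y0 h; rewrite sp -[leRHS]ger0_norm// -sqrtr_sqr ler_wsqrtr.
have th : C * s <= 1 / 2.
  rewrite -ler_pdivlMl//; apply: le_trans spl _; apply: sq.
    by rewrite mulr_ge0 ?invr_ge0 ?ltW.
  by apply: le_trans h2 _; rewrite le_eqVlt; apply/orP; left; apply/eqP; field; exact: lt0r_neq0.
apply: le_trans (sum_term_le pn (indX n) (unifX n) CE pk n2 En p3n th hb) _.
have -> : e = e / 3 + e / 3 + e / 3 by field.
apply: lerD; first apply: lerD => //.
  rewrite lerBlDl -/s; apply: (@le_trans _ _ (expR (2 * (C * s)) ^+ p n)).
    apply: lerXn2r; rewrite ?nnegrE ?expR_ge0 ?expR_ge1Dx//.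
    by rewrite addr_ge0// mulr_ge0// mulr_ge0// ltW.
  rewrite -expRM_natr -[leRHS]lnK ?posrE ?addr_gt0// ler_expR -/x0.
  have y0 : 0 <= x0 / (2 * C) by rewrite ltW// divr_gt0// mulr_gt0.
  have := sq _ y0 h1.
  rewrite ler_pdivlMr ?mulr_gt0//; lra.
by rewrite -[leRHS]invrK lef_pV2 ?posrE ?invr_gt0// invf_div.
Unshelve. all: by end_near. Qed.
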